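(* Let $\bar\rho$ and $\bar\sigma$ be r.i. norms on $M_+(\mathbb{R}_+)$, and let $\rho$ and $\sigma$ be the r.i. norms on $M_+(\mathbb{R}^n)$ given by $\rho(f)=\bar\rho(f^* )$ and $\sigma(f)=\bar\sigma(f^* )$, $f\in M_+(\mathbb{R}^n)$. Assume that there is a constant $C>0$ such that $$\bar\rho(g^{**})\le C\,\bar\rho(g^* ),\qquad g\in M_+(\mathbb{R}_+).$$ Suppose there is a constant $C>0$ such that $$\rho(\hat f)\le C\,\sigma(f)$$ for all $f\in (L_1\cap L_\sigma)(\mathbb{R}^n)$ of the form $f(x)=g(|x|)$, $x\in\mathbb{R}^n$, with $g$ nonincreasing on $\mathbb{R}_+$. Then there is a constant $C>0$ such that $$\bar\rho(Uh^* )\le C\,\bar\sigma(h^* ),\qquad h\in L_{\bar\sigma}(\mathbb{R}_+).$$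
   Context: $\mathbb{R}_+=(0,\infty)$; $\Omega$ denotes $\mathbb{R}^n$ or $\mathbb{R}_+$ with Lebesgue measure $|\cdot|$. $M(\Omega)$ is the class of measurable functions on $\Omega$ and $M_+(\Omega)$ the nonnegative ones. For $f\in M(\Omega)$, $\mu_f(\lambda)=|\{x\in\Omega:|f(x)|>\lambda\}|$, $f^*$ is the nonincreasing rearrangement $f^*(t)=\inf\{\lambda\ge 0:\mu_f(\lambda)\le t\}$, $t\in\mathbb{R}_+$, and $f^{**}(t)=t^{-1}\int_0^t f^*$. An r.i. (rearrangement-invariant) norm on $M_+(\Omega)$ is a functional $\rho:M_+(\Omega)\to[0,\infty]$ such that: $\rho(f)=0$ iff $f=0$ a.e.; $\rho(cf)=c\rho(f)$ for $c>0$; $\rho(f+g)\le\rho(f)+\rho(g)$; $0\le f_n\uparrow f$ implies $\rho(f_n)\uparrow\rho(f)$; $\rho(\chi_E)<\infty$ whenever $|E|<\infty$; $\int_E f\le C_E\,\rho(f)$ whenever $|E|<\infty$, with $C_E$ independent of $f$; $\rho(f)=\rho(g)$ whenever $\mu_f=\mu_g$. One writes $\rho(f)$ for $\rho(|f|)$ when $f\in M(\Omega)$, and $L_\rho(\Omega)=\{f\in M(\Omega):\rho(|f|)<\infty\}$. The Fourier transform is $\hat f(\xi)=\int_{\mathbb{R}^n}f(x)e^{-2\pi i\xi\cdot x}\,dx$ for $f\in L_1(\mathbb{R}^n)$. The operator $U$ is $(Uh)(s)=\int_0^{1/s}h$, $h\in M_+(\mathbb{R}_+)$, $s\in\mathbb{R}_+$.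 *)

(* Defs.v *)
From HB Require Import structures.
From mathcomp Require Import all_boot all_order all_algebra.
From mathcomp Require Import all_classical all_reals all_analysis.
From mathcomp Require Import measurable_realfun.
From mathcomp Require Import complex.

Set Implicit Arguments.
Unset Strict Implicit.
Unset Printing Implicit Defensive.

Import Order.TTheory GRing.Theory Num.Theory.
Import numFieldNormedType.Exports.

Local Open Scope classical_set_scope.
Local Open Scope ring_scope.
Local Open Scope complex_scope.
Local Open Scope ereal_scope.

Section lebesgue_Rn.
Context {R : realType}.

Definition tcons n (xy : measurableTypeR R * n.-tuple R) : n.+1.-tuple R :=
  [tuple of xy.1 :: xy.2].

Lemma measurable_tcons n : measurable_fun setT (@tcons n).
Proof. exact: measurable_cons. Qed.

(* R^n is n.-tuple R with its product sigma-algebra.  Its Lebesgue measure is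
   the n-fold product of the one-dimensional one; R^0 is a point of mass 1. *)
Fixpoint lebesgue_Rn (n : nat) : set (n.-tuple R) -> \bar R :=
  match n with
  | 0 => \d_([tuple] : 0.-tuple R)
  | m.+1 => pushforward (lebesgue_measure \x @lebesgue_Rn m) (@tcons m)
  end.
Arguments lebesgue_Rn : clear implicits.

Let lebesgue_RnP n : exists nu : {sigma_finite_measure set (n.-tuple R) -> \bar R},
  (nu : set _ -> \bar R) = lebesgue_Rn n.
Proof.
elim: n => [|n [nu nuE]] /=; first by exists (\d_([tuple] : 0.-tuple R)).
rewrite -nuE.
have mtc := @measurable_tcons n.
have [P PE] : exists P : {measure set (n.+1.-tuple R) -> \bar R},
    (P : set _ -> \bar R) = pushforward (lebesgue_measure \x nu) (@tcons n).
  by exists (measure_function_pushforward__canonical__measure_function_Measure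
    (lebesgue_measure \x nu) mtc).
have sP : sigma_finite setT P.
  have /sigma_finiteP[F [TF ndF Foo]] := sigma_finiteT (@lebesgue_measure R).
  have /sigma_finiteP[G [TG ndG Goo]] := sigma_finiteT nu.
  exists (fun k => [set t | F k (thead t) /\ G k [tuple of behead t]]).
    apply/esym; rewrite -subTset => t _.
    have : setT (thead t) by []. rewrite TF => -[i _ Fi].
    have : setT [tuple of behead t] by []. rewrite TG => -[j _ Gj].
    exists (maxn i j) => //; split.
      by move: Fi; apply/subsetPset/ndF/leq_maxl.
    by move: Gj; apply/subsetPset/ndG/leq_maxr.
  move=> k; have [mF Fk] := Foo k; have [mG Gk] := Goo k; split.
    apply: measurableI.
      by rewrite -[X in measurable X]setTI; exact: (measurable_tnth ord0).
    by rewrite -[X in measurable X]setTI; exact: measurable_behead.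
  rewrite PE /pushforward (_ : _ @^-1` _ = F k `*` G k); last first.
    apply/seteqP; split=> -[x y] /=; rewrite theadE (_ : [tuple of _] = y)//;
      by apply/val_inj.
  by rewrite product_measure1E// lte_mul_pinfty// ge0_fin_numE.
pose i := @isSFinite.Build _ _ _ P (sfinite_measure_sigma_finite sP).
pose j := @isSigmaFinite.Build _ _ _ P sP.
pose Q : {sigma_finite_measure set (n.+1.-tuple R) -> \bar R} :=
  HB.pack (Measure.sort P) i j.
by rewrite -PE; exists Q.
Qed.

Variable n : nat.

Let lebesgue_Rn0 : lebesgue_Rn n set0 = 0.
Proof. by have [nu <-] := lebesgue_RnP n. Qed.

Let lebesgue_Rn_ge0 A : 0 <= lebesgue_Rn n A.
Proof. by have [nu <-] := lebesgue_RnP n. Qed.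

Let lebesgue_Rn_sigma_additive : semi_sigma_additive (lebesgue_Rn n).
Proof.
by have [nu <-] := lebesgue_RnP n; exact: measure_semi_sigma_additive.
Qed.

HB.instance Definition _ := isMeasure.Build _ _ _ (lebesgue_Rn n)
  lebesgue_Rn0 lebesgue_Rn_ge0 lebesgue_Rn_sigma_additive.

Let lebesgue_Rn_sigma_finite : sigma_finite setT (lebesgue_Rn n).
Proof. by have [nu <-] := lebesgue_RnP n; exact: sigma_finiteT. Qed.

HB.instance Definition _ := Measure_isSigmaFinite.Build _ _ _ (lebesgue_Rn n)
  lebesgue_Rn_sigma_finite.

End lebesgue_Rn.
Arguments lebesgue_Rn R n : clear implicits.

Section rearrangement.
Context {d : measure_display} {T : measurableType d} {R : realType}.
Variables (mu : set T -> \bar R) (Omega : set T).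
Implicit Types (f g : T -> \bar R) (rho : (T -> \bar R) -> \bar R).

Definition Mplus f :=
  measurable_fun Omega f /\ (forall x, Omega x -> 0 <= f x).

(* distribution function mu_f *)
Definition mu_fun f (lambda : R) : \bar R :=
  mu (Omega `&` [set x | lambda%:E < `|f x|]).

(* +oo when no lambda qualifies *)
Definition rearr f (t : R) : \bar R :=
  ereal_inf [set lambda%:E | lambda in
    [set lambda : R | (0 <= lambda)%R /\ mu_fun f lambda <= t%:E]].

(* Functions on Omega are total functions on T.  Each axiom only looks at
   values on Omega, and ri_equimeasurable makes rho independent of the values
   of its argument outside Omega. *)
Record ri_norm rho : Prop := RiNorm {
  ri_ge0 : forall f, Mplus f -> 0 <= rho f ;
  ri_eq0 : forall f, Mplus f ->
    (rho f = 0 <-> {ae mu, forall x, Omega x -> f x = 0}) ;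
  ri_scale : forall f (c : R), Mplus f -> (0 < c)%R ->
    rho (fun x => c%:E * f x) = c%:E * rho f ;
  ri_triangle : forall f g, Mplus f -> Mplus g ->
    rho (f \+ g) <= rho f + rho g ;
  ri_fatou : forall (f_ : nat -> T -> \bar R) f,
    (forall k, Mplus (f_ k)) -> Mplus f ->
    (forall x, Omega x -> nondecreasing_seq (fun k => f_ k x)) ->
    (forall x, Omega x -> f_ k x @[k --> \oo] --> f x) ->
    nondecreasing_seq (fun k => rho (f_ k)) /\
    rho (f_ k) @[k --> \oo] --> rho f ;
  ri_finite : forall E, measurable E -> E `<=` Omega -> mu E < +oo ->
    rho (fun x => (\1_E x)%:E) < +oo ;
  ri_integral : forall E, measurable E -> E `<=` Omega -> mu E < +oo ->
    exists2 C : R, (0 < C)%R &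
      forall f, Mplus f -> \int[mu]_(x in E) f x <= C%:E * rho f ;
  ri_equimeasurable : forall f g, Mplus f -> Mplus g ->
    (forall lambda : R, (0 <= lambda)%R -> mu_fun f lambda = mu_fun g lambda) ->
    rho f = rho g
}.

Definition Lri rho f := measurable_fun Omega f /\ rho (abse \o f) < +oo.

End rearrangement.

Section half_line.
Context {R : realType}.
Implicit Types (h g : R -> \bar R).

Definition Rplus : set R := `]0%R, +oo[.

Definition rearrR h : R -> \bar R := rearr (@lebesgue_measure R) Rplus h.

(* h^** *)
Definition avg_rearr h (t : R) : \bar R :=
  (t^-1)%:E * \int[lebesgue_measure]_(s in `]0%R, t[) rearrR h s.

Definition opU h (s : R) : \bar R :=
  \int[lebesgue_measure]_(t in `]0%R, (s^-1)%R[) h t.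

End half_line.
Arguments Rplus R : clear implicits.

Section Rn.
Context {R : realType} {n : nat}.
Local Notation Rn := (n.-tuple R).

Definition rearrRn (f : Rn -> \bar R) : R -> \bar R :=
  rearr (lebesgue_Rn R n) setT f.

Definition lift_norm (rhobar : (R -> \bar R) -> \bar R) (f : Rn -> \bar R) :
  \bar R := rhobar (rearrRn f).

Definition dotp (x y : Rn) : R := (\sum_(i < n) tnth x i * tnth y i)%R.

Definition enorm (x : Rn) : R := Num.sqrt (dotp x x).

(* e^(it) *)
Definition cis (t : R) : R[i] := (cos t +i* sin t)%C.

Definition Cintegral (F : Rn -> R[i]) : R[i] :=
  ((\int[lebesgue_Rn R n]_x complex.Re (F x))%R +i*
   (\int[lebesgue_Rn R n]_x complex.Im (F x))%R)%C.

Definition fourier (f : Rn -> R[i]) (xi : Rn) : R[i] :=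
  Cintegral (fun x => (f x * cis (- (2 * pi * dotp xi x)))%R).

Definition cabs (z : R[i]) : R := complex.Re `|z|%R.

End Rn.

(* Main.v *)
(** Let [H >= 0] be nonincreasing on the half line and [f x = H ((pi |x|) ^ n)].
    Balls sit inside cubes, so [f^* <= H].  Conversely, pair [f^] with the
    product [phi] of triangle functions supported in the cube [[-r, r]^n],
    [(2 r)^n = t].  The Fourier transform of [phi] is nonnegative and at least
    [c r^n] on the cube [(0, 1/(2 pi r)]^n], so with Fubini and the
    Hardy--Littlewood inequality
      [r^n \int_0^(1/t) H <= C r^n \int_((0,1/(2 pi r)]^n) f
        <= C' \int f phi^ = C' \int f^ phi <= C' \int_0^t (f^)^*],
    that is, [U H <= C'' (f^)^**] pointwise.  Applying this to the truncations
    of [h^*] to [(0, k)], which make [f] integrable, the bound on [g^**] and the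
    Fourier hypothesis give the claim for the truncations, and the Fatou
    property of the norm removes the truncation. *)

Require Import Defs.
From mathcomp Require Import all_boot all_order all_algebra.
From mathcomp Require Import all_classical all_reals all_analysis.
From mathcomp Require Import measurable_realfun.
From mathcomp Require Import complex.
From mathcomp Require Import ring lra.

Import Order.TTheory GRing.Theory Num.Theory.
Import numFieldNormedType.Exports.
Local Open Scope classical_set_scope.
Local Open Scope ring_scope.
Local Open Scope ereal_scope.

Set Implicit Arguments.
Unset Strict Implicit.
Unset Printing Implicit Defensive.

(** * Layer-cake comparison of integrals *)

Lemma measurable_Rplus {R : realType} :
  measurable (Rplus R : set (measurableTypeR R)).
Proof. exact: measurable_itv. Qed.
#[local] Hint Resolve measurable_Rplus : core.

Lemma RplusP {R : realType} (x : R) : Rplus R x <-> (0 < x)%R.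
Proof. by rewrite /Rplus/= in_itv/= andbT. Qed.

Section layer_cake.
Context {d : measure_display} {T : measurableType d} {R : realType}.
Variable mu : {sigma_finite_measure set T -> \bar R}.
Local Notation leb := (@lebesgue_measure R).

(** Tonelli on the region under the graph of [F], sliced both ways. The comparison is a parameter so
    that strict and weak superlevel sets share one proof. *)
Lemma layer_cake (cmp : R -> \bar R -> bool) (D : set T) (F : T -> \bar R) :
  measurable D -> (forall x, D x -> 0 <= F x) ->
  measurable ((D `*` Rplus R) `&` [set z | cmp z.2 (F z.1)] :
    set (T * measurableTypeR R)) ->
  (forall y, 0 <= y -> leb (Rplus R `&` [set l | cmp l y]) = y) ->
  \int[mu]_(x in D) F x =
  \int[leb]_(l in Rplus R) mu (D `&` [set x | cmp l (F x)]).
Proof.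
move=> mD F0; set A := (X in measurable X) => mA cmpE.
have AE : \int[mu]_x leb (xsection A x) = \int[leb]_l mu (ysection A l).
  have := indic_fubini_tonelli mu leb mA.
  by rewrite (indic_fubini_tonelli_FE leb mA) (indic_fubini_tonelli_GE mu mA).
have AxE x l : (x, l) \in A <-> [/\ D x, Rplus R l & cmp l (F x)].
  by rewrite inE; split=> [[[? ?] ?]|[? ? ?]].
rewrite integral_mkcond [RHS]integral_mkcond.
transitivity (\int[mu]_x leb (xsection A x)); last first.
  rewrite AE; apply: eq_integral => l _ /=; rewrite patchE.
  case: ifPn => [/set_mem l0|/negP l0].
    by congr (mu _); apply/seteqP; split=> x; rewrite /ysection/= AxE => -[].
  rewrite (_ : ysection A l = set0) ?measure0//; apply/seteqP; split=> // x.
  by rewrite /ysection/= AxE => -[_ /mem_set].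
apply: eq_integral => x _; rewrite patchE; case: ifPn => [/set_mem Dx|/negP xD].
  rewrite -[LHS]cmpE ?F0//; congr (leb _).
  by apply/seteqP; split=> l; rewrite /xsection/= AxE => -[].
rewrite (_ : xsection A x = set0) ?measure0//; apply/seteqP; split=> // l.
by rewrite /xsection/= AxE => -[/mem_set].
Qed.

End layer_cake.

Lemma measurable_fst_snd {d : measure_display} {T : measurableType d}
    {R : realType} (D : set T) (F : T -> \bar R) : measurable D ->
  measurable_fun D F ->
  measurable_fun (D `*` Rplus R) (fun z : T * measurableTypeR R => F z.1) /\
  measurable_fun (D `*` Rplus R) (fun z : T * measurableTypeR R => z.2%:E).
Proof.
move=> mD mF; split; last first.
  by apply/measurable_EFinP; exact: measurable_funTS.
apply: (@measurable_comp _ _ _ _ _ _ D) => //; first by move=> _ [z [Dz _] <-].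
exact: measurable_funTS.
Qed.

(* Comparing strict superlevel sets with weak ones spares any discussion of the
   right-continuity of distribution functions. *)
Lemma integral_le_layers {d d' : measure_display} {T : measurableType d}
    {T' : measurableType d'} {R : realType}
    (mu : {sigma_finite_measure set T -> \bar R})
    (nu : {sigma_finite_measure set T' -> \bar R})
    (D : set T) (E : set T') (F : T -> \bar R) (G : T' -> \bar R) (K : R) :
  measurable D -> measurable E -> measurable_fun D F -> measurable_fun E G ->
  (forall x, D x -> 0 <= F x) -> (forall x, E x -> 0 <= G x) -> (0 <= K)%R ->
  (forall l : R, (0 < l)%R -> nu (E `&` [set x | l%:E < G x]) <=
    K%:E * mu (D `&` [set x | l%:E <= F x])) ->
  \int[nu]_(x in E) G x <= K%:E * \int[mu]_(x in D) F x.
Proof.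
move=> mD mE mF mG F0 G0 K0 le.
have [mF1 mF2] := measurable_fst_snd mD mF.
have [mG1 mG2] := measurable_fst_snd mE mG.
have mDR : measurable (D `*` Rplus R : set (T * measurableTypeR R)) by
  apply: measurableX => //; exact: measurable_Rplus.
have mER : measurable (E `*` Rplus R : set (T' * measurableTypeR R)) by
  apply: measurableX => //; exact: measurable_Rplus.
have mS : measurable ((D `*` Rplus R) `&` [set z | z.2%:E <= F z.1] :
    set (T * measurableTypeR R)).
  exact: measurable_lee.
have mS' : measurable ((E `*` Rplus R) `&` [set z | z.2%:E < G z.1] :
    set (T' * measurableTypeR R)).
  exact: measurable_lte.
(* The measure of a layer is measurable in the level, being the measure of a section of the subgraph
   [S]. *)
have msec (d0 : measure_display) (T0 : measurableType d0)
    (m0 : {sigma_finite_measure set T0 -> \bar R}) (D0 : set T0) (S : set (T0 * measurableTypeR R))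
    (P : T0 -> R -> Prop) : measurable S ->
    (forall x l, S (x, l) <-> (D0 x /\ Rplus R l) /\ P x l) ->
    measurable_fun (Rplus R) (fun l => m0 (D0 `&` [set x | P x l])).
  move=> mS0 SE; apply: (@eq_measurable_fun _ _ _ _ _ (m0 \o ysection S)).
    move=> l /set_mem l0 /=; congr (m0 _); apply/seteqP; split=> x;
      by rewrite /ysection/= inE SE => -[] // -[].
  apply: measurable_funTS; exact: (@measurable_fun_ysection _ _ T0 (measurableTypeR R)).
have itv (y : \bar R) : 0 <= y -> forall b,
    lebesgue_measure (Rplus R `&` [set l | if b then l%:E <= y else l%:E < y]) = y.
  move=> y0 b.
  case: y y0 => [r| |]//= r0; rewrite ?lee_fin in r0.
    (* [b] decides whether the right endpoint [r] belongs to the interval; the length is [r] either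
       way. *)
    rewrite (_ : _ `&` _ = [set` Interval (BRight 0%R) (BSide (~~ b) r)]).
      rewrite lebesgue_measure_itv/= lte_fin; case: ltgtP r0 => [|//|<-//].
      by rewrite sube0.
    apply/seteqP; split=> l; rewrite /Rplus/= !in_itv/= ?andbT;
      by case: b => /=; rewrite ?lee_fin ?lte_fin => -[] *; apply/andP.
  rewrite (_ : _ `&` _ = Rplus R) ?lebesgue_measure_itv/= ?ltry//.
  by apply/seteqP; split=> l /=; [case|case: b; rewrite ?leey ?ltry].
rewrite (@layer_cake _ _ _ nu (fun l y => l%:E < y))//; last first.
  by move=> y y0; rewrite -[RHS](itv _ y0 false).
rewrite (@layer_cake _ _ _ mu (fun l y => l%:E <= y) D F)//; last first.
  by move=> y y0; rewrite -[RHS](itv _ y0 true).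
rewrite -ge0_integralZl//; last first.
  by apply: (msec _ _ mu D _ (fun x l => (l%:E <= F x)%E) mS).
apply: ge0_le_integral => //.
- by apply: (msec _ _ nu E _ (fun x l => (l%:E < G x)%E) mS').
- apply: emeasurable_funM => //.
  by apply: (msec _ _ mu D _ (fun x l => (l%:E <= F x)%E) mS).
- by move=> l /RplusP; exact: le.
Qed.

(** * Decreasing rearrangements *)

(** Superlevel sets of a monotone function on an interval are intervals, and open upper rays
    generate the extended Borel sets. *)
Lemma nonincreasing_emeasurable {R : realType} (D : set R) (f : R -> \bar R) :
  is_interval D -> (forall s t, D s -> D t -> (s <= t)%R -> f t <= f s) ->
  measurable_fun (D : set (measurableTypeR R)) f.
Proof.
move=> iD fD mD; apply: (measurability _ (ErealGenOInfty.measurableE R)) => //.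
move=> _ [_ [r ->] <-]; apply: is_interval_measurable => s t.
move=> [/= Ds]; rewrite !in_itv/= !andbT => rs [/= Dt rt].
move=> u /andP[su ut]; have Du : D u by apply: (iD s t) => //; apply/andP.
by split => //=; rewrite in_itv/= andbT (lt_le_trans rt)// fD.
Qed.

Lemma nondecreasing_emeasurable {R : realType} (D : set R) (f : R -> \bar R) :
  is_interval D -> (forall s t, D s -> D t -> (s <= t)%R -> f s <= f t) ->
  measurable_fun (D : set (measurableTypeR R)) f.
Proof.
move=> iD fD; rewrite (_ : f = \- (\- f)); last first.
  by apply/funext => x /=; rewrite oppeK.
apply: measurableT_comp => //; apply: nonincreasing_emeasurable => // s t Ds Dt st.
by rewrite leeN2 fD.
Qed.

Lemma is_interval_Rplus {R : realType} : is_interval (Rplus R).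
Proof. exact: interval_is_interval. Qed.

Lemma lebesgue_measure_0oo {R : realType} (t : R) : (0 <= t)%R ->
  lebesgue_measure `]0%R, t[%classic = t%:E.
Proof.
move=> t0; rewrite lebesgue_measure_itv/= lte_fin; case: ltgtP t0 => [|//|<-//].
by rewrite sube0.
Qed.

Section rearr.
Context {d : measure_display} {T : measurableType d} {R : realType}.
Variables (mu : {measure set T -> \bar R}) (Omega : set T).
Hypothesis mOmega : measurable Omega.
Implicit Type f : T -> \bar R.

Lemma rearr_nonincreasing f (s t : R) : (s <= t)%R ->
  rearr mu Omega f t <= rearr mu Omega f s.
Proof.
move=> st; apply: ereal_inf_le_tmp => _ [l [l0 ls] <-]; exists l => //; split => //.
by rewrite (le_trans ls)// lee_fin.
Qed.

Lemma rearr_ge0 f t : 0 <= rearr mu Omega f t.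
Proof. by apply: le_ereal_inf_tmp => _ [l [l0 _] <-]; rewrite lee_fin. Qed.

Lemma rearr_le f (l t : R) : (0 <= l)%R -> mu_fun mu Omega f l <= t%:E ->
  rearr mu Omega f t <= l%:E.
Proof. by move=> l0 lt; apply: ereal_inf_lbound; exists l. Qed.

Lemma measurable_rearr f (D : set R) : is_interval D ->
  measurable_fun (D : set (measurableTypeR R)) (rearr mu Omega f).
Proof.
move=> iD; apply: nonincreasing_emeasurable => // s t _ _.
exact: rearr_nonincreasing.
Qed.

Lemma mu_fun_nonincreasing f (k l : R) : measurable_fun Omega f -> (k <= l)%R ->
  mu_fun mu Omega f l <= mu_fun mu Omega f k.
Proof.
move=> mf kl; have mset (c : R) : measurable (Omega `&` [set x | c%:E < `|f x|]).
  by apply: measurable_lte => //; exact: measurableT_comp.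
apply: le_measure; rewrite ?inE// => x [Ox /= lx]; split => //=.
by rewrite (le_lt_trans _ lx)// lee_fin.
Qed.

End rearr.

(** By monotonicity the set where [g] exceeds [g t] lies in []0, t[], so [g t] is an admissible
    level. Equality can fail at a jump of [g]. *)
Lemma rearrR_le {R : realType} (g : R -> \bar R) (t : R) :
  (forall s t, Rplus R s -> Rplus R t -> (s <= t)%R -> g t <= g s) ->
  (forall s, Rplus R s -> 0 <= g s) -> (0 < t)%R ->
  rearrR g t <= g t.
Proof.
move=> gni g0 t0; have Rt : Rplus R t by apply/RplusP.
have := g0 _ Rt; case gtE : (g t) => [r| |]//; rewrite ?leey// lee_fin => r0.
have mg : measurable_fun (Rplus R : set (measurableTypeR R)) g.
  by apply: nonincreasing_emeasurable => //; exact: is_interval_Rplus.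
apply: rearr_le => //; rewrite -(lebesgue_measure_0oo (ltW t0)).
apply: le_measure; rewrite ?inE//.
  apply: measurable_lte => //.
  exact: (measurableT_comp _ mg).
move=> s [/[dup] Rs /RplusP s0 /=]; rewrite gee0_abs ?g0// in_itv/= s0/= => rs.
by rewrite ltNge; apply: contraTN rs => ts; rewrite -leNgt -gtE gni.
Qed.

Section rearr_sfinite.
Context {d : measure_display} {T : measurableType d} {R : realType}.
Variables (mu : {sigma_finite_measure set T -> \bar R}) (Omega : set T).
Hypothesis mOmega : measurable Omega.
Implicit Type f : T -> \bar R.

(** With [rearrR_le], this makes rearranging twice the same as rearranging once on the half line.
    Two small slacks stand in for right-continuity. *)
Lemma rearr_le_rearrR f (t : R) : measurable_fun Omega f -> (0 < t)%R ->
  rearr mu Omega f t <= rearrR (rearr mu Omega f) t.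
Proof.
move=> mf t0; apply: le_ereal_inf_tmp => _ [l [l0 lt] <-].
(* The slack [e] in the level lets an admissible level undercut [l + e]; the slack [h] makes []0, t
   + h[] too long for a level set of measure at most [t]. *)
apply/lee_addgt0Pr => e e0; rewrite -EFinD; apply: rearr_le.
  by rewrite addr_ge0// ltW.
apply/lee_addgt0Pr => h h0; rewrite -EFinD.
have td0 : (0 < t + h)%R by rewrite addr_gt0.
have mr : measurable_fun (Rplus R : set (measurableTypeR R)) (rearr mu Omega f).
  by apply: measurable_rearr; exact: is_interval_Rplus.
have le : rearr mu Omega f (t + h)%R <= l%:E.
  rewrite leNgt; apply/negP => lth.
  have : (t + h)%:E <= t%:E; last by rewrite lee_fin; lra.
  apply: le_trans lt; rewrite -(lebesgue_measure_0oo (ltW td0)).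
  apply: le_measure; rewrite ?inE//.
    apply: measurable_lte => //.
    exact: (measurableT_comp _ mr).
  move=> s /=; rewrite in_itv/= => /andP[s0 st]; split; first exact/RplusP.
  rewrite /= gee0_abs ?rearr_ge0// (lt_le_trans lth)//.
  by apply: rearr_nonincreasing; exact: ltW.
have {}le : rearr mu Omega f (t + h)%R < (l + e)%:E.
  by rewrite (le_lt_trans le)// lte_fin; lra.
have [_ [k [k0 kt] <-]] := ereal_inf_lt le.
rewrite lte_fin => kl; apply: le_trans kt.
by apply: mu_fun_nonincreasing => //; exact: ltW.
Qed.

(** Hardy--Littlewood inequality against an indicator: the layer of [f] above [l] inside [E] has
    measure [m <= t], and the rearrangement is at least [l] on []0, m[]. *)
Lemma integral_le_rearr f (E : set T) (t : R) :
  measurable_fun Omega f -> (forall x, Omega x -> 0 <= f x) ->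
  measurable E -> E `<=` Omega -> (0 <= t)%R -> mu E <= t%:E ->
  \int[mu]_(x in E) f x <=
  \int[lebesgue_measure]_(s in `]0%R, t[) rearr mu Omega f s.
Proof.
move=> mf f0 mE EO t0 Et.
have itv : is_interval `]0%R, t[%classic by exact: interval_is_interval.
rewrite -[leRHS]mul1e; apply: integral_le_layers => //.
- exact: measurable_rearr.
- exact: measurable_funS mf.
- by move=> *; exact: rearr_ge0.
- by move=> x /EO; exact: f0.
move=> l l0; rewrite mul1e; set A := E `&` _.
have mA : measurable A by apply: measurable_lte => //; exact: measurable_funS mf.
have At : mu A <= t%:E.
  by apply: le_trans Et; apply: le_measure; rewrite ?inE// => x [].
have [m mE'] : exists m : R, mu A = m%:E.
  exists (fine (mu A)); rewrite fineK// ge0_fin_numE//.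
  by rewrite (le_lt_trans At)// ltry.
rewrite mE' in At *; have m0 : (0 <= m)%R by rewrite -lee_fin -mE'.
rewrite -(lebesgue_measure_0oo m0); apply: le_measure; rewrite ?inE//.
  by apply: measurable_lee => //; exact: measurable_rearr.
move=> s /=; rewrite !in_itv/= => /andP[s0 sm]; split.
  by rewrite s0/= (lt_le_trans sm).
(* An admissible level [k < l] at [s < m] would put the layer, of measure [m], inside a set of
   measure at most [s]. *)
apply: le_ereal_inf_tmp => _ [k [k0 ks] <-]; rewrite lee_fin leNgt; apply/negP => kl.
have : m%:E <= s%:E; last by rewrite lee_fin; lra.
apply: le_trans ks; rewrite -mE'; apply: le_measure; rewrite ?inE//.
  by apply: measurable_lte => //; exact: measurableT_comp.
move=> x [Ex /= lx]; split; [exact: EO|]; rewrite /= gee0_abs ?f0//; last exact: EO.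
by rewrite (lt_trans _ lx)// lte_fin.
Qed.

End rearr_sfinite.

(** * Boxes and iterated integrals in R^n *)

Section lebesgue_Rn_facts.
Context {R : realType}.
Local Notation leb := (@lebesgue_measure R).
Local Notation lebn := (lebesgue_Rn R).

Definition box n (I : set R) : set (n.-tuple R) :=
  [set x | forall i, I (tnth x i)].

Lemma box_tcons n (I : set R) (z : R * n.-tuple R) :
  @box n.+1 I (tcons z) <-> I z.1 /\ @box n I z.2.
Proof.
split=> [Iz|[I1 I2] i].
  split=> [|i]; first by have := Iz ord0; rewrite tnth0.
  by have := Iz (lift ord0 i); rewrite tnthS.
by case: (unliftP ord0 i) => [j|] ->; rewrite ?tnthS ?tnth0.
Qed.

Lemma measurable_box n (I : set R) : measurable I -> measurable (@box n I).
Proof.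
move=> mI; rewrite (_ : box I = \big[setI/setT]_(i < n) ((fun x => tnth x i) @^-1` I)).
  apply: bigsetI_measurable => i _; rewrite -[X in measurable X]setTI.
  exact: (measurable_tnth i).
by rewrite -bigcap_seq; apply/seteqP; split=> x /= xI i; [move=> _|]; apply: xI;
  rewrite /= ?mem_index_enum.
Qed.

Lemma lebesgue_Rn_box n (I : set R) (c : R) : measurable I -> leb I = c%:E ->
  lebn n (box I) = (c ^+ n)%:E.
Proof.
move=> mI Ic; elim: n => [|n IHn].
  rewrite expr0 /= diracE mem_set// => i; by case: i.
rewrite (_ : lebn n.+1 (box I) = (leb \x lebn n) (I `*` box I)).
  transitivity (leb I * lebn n (box I)); last by rewrite Ic IHn exprS EFinM.
  by apply: product_measure1E => //; exact: measurable_box.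
congr ((leb \x lebn n) _).
by apply/seteqP; split=> z; rewrite /= box_tcons.
Qed.

(** The measure in dimension [n.+1] is the image of a product under [tcons], so Tonelli peels off
    the first coordinate. *)
Lemma ge0_integral_lebesgue_RnS n (F : n.+1.-tuple R -> \bar R) :
  measurable_fun setT F -> (forall x, 0 <= F x) ->
  \int[lebn n.+1]_x F x = \int[leb]_u \int[lebn n]_y F (tcons (u, y)).
Proof.
move=> mF F0.
have mt := @measurable_tcons R n.
transitivity (\int[leb \x lebn n]_z (F \o @tcons R n) z).
  exact: (@ge0_integral_pushforward _ _ _ _ _ _ mt (leb \x lebn n) setT F).
have mFt : measurable_fun setT (F \o @tcons R n) := measurableT_comp mF mt.
apply: (@fubini_tonelli1 _ _ _ _ _ leb (lebn n) (F \o @tcons R n) mFt) => z.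
exact: F0.
Qed.

Lemma integrable_lebesgue_RnS n (F : n.+1.-tuple R -> \bar R) :
  (lebn n.+1).-integrable setT F ->
  (leb \x lebn n).-integrable setT (F \o @tcons R n).
Proof.
move=> /integrableP[mF Fy]; apply/integrable12ltyP.
  exact: (measurableT_comp mF (@measurable_tcons R n)).
rewrite ge0_integral_lebesgue_RnS// in Fy.
exact: (measurableT_comp _ mF).
Qed.

Lemma integral_lebesgue_RnS n (F : n.+1.-tuple R -> \bar R) :
  (lebn n.+1).-integrable setT F ->
  \int[lebn n.+1]_x F x = \int[leb]_u \int[lebn n]_y F (tcons (u, y)).
Proof.
move=> iF; have mF := measurable_int _ iF.
have iF' := integrable_lebesgue_RnS iF.
transitivity (\int[leb \x lebn n]_z (F \o @tcons R n) z).
  exact: (@integral_pushforward _ _ _ _ _ _ (@measurable_tcons R n)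
    (leb \x lebn n) setT F).
by rewrite -integral12_prod_meas1.
Qed.

End lebesgue_Rn_facts.

(** * The triangle kernel *)

Section triangle_kernel.
Context {R : realType}.
Local Notation leb := (@lebesgue_measure R).
Local Open Scope ring_scope.

(** The Fourier transform of this hat function is a Fejer kernel, which is nonnegative and of size
    comparable to [r] near the origin. *)
Definition tri (r u : R) : R := if `|u| <= r then 1 - `|u| / r else 0.

Lemma tri_ge0 (r u : R) : 0 < r -> 0 <= tri r u.
Proof.
by move=> r0; rewrite /tri; case: ifPn => // ur; rewrite subr_ge0 ler_pdivrMr ?mul1r.
Qed.

Lemma tri_le1 (r u : R) : 0 < r -> tri r u <= 1.
Proof.
by move=> r0; rewrite /tri; case: ifPn => // ur; rewrite gerBl divr_ge0// ltW.
Qed.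

Lemma measurable_tri (r : R) : measurable_fun setT (tri r).
Proof.
apply: measurable_fun_ifT => //.
  by apply: measurable_fun_ler => //; exact: measurableT_comp.
by apply: measurable_funB => //; apply: measurable_funM => //; exact: measurableT_comp.
Qed.

Lemma ge0_continuous_FTC2 (f F : R -> R) (r : R) : 0 < r -> continuous f ->
  (forall x : R, is_derive x 1 F (f x)) ->
  (\int[leb]_(x in `[0%R, r]) (f x)%:E = (F r - F 0)%:E)%E.
Proof.
move=> r0 cf dF; have cF : continuous F.
  by move=> x; apply/differentiable_continuous/derivable1_diffP/ex_derive.
rewrite (@continuous_FTC2 _ f F)//.
- exact: continuous_subspaceT.
- split; first by move=> x _; exact: ex_derive.
    by apply: cvg_at_right_filter; exact: cF.
  by apply: cvg_at_left_filter; exact: cF.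
- by move=> x _; rewrite derive1E; exact: derive_val.
Qed.

(** [tri] is even, so the integral folds at 0: the absolute value disappears, and an odd [G] cancels
    at once. *)
Lemma integral_tri_mul (r : R) (G : R -> R) : 0 < r -> continuous G ->
  (\int[leb]_u (tri r u * G u)%:E =
   \int[leb]_(u in `[0%R, r]) ((1 - u / r) * (G u + G (- u)))%:E)%E.
Proof.
move=> r0 cG; pose h u := (1 - `|u| / r) * G u.
have ch : continuous h.
  move=> u; apply: cvgM; last exact: cG.
  apply: cvgB; first exact: cvg_cst.
  by apply: cvgMl; exact: norm_continuous.
have mh (D : set R) : measurable D -> measurable_fun D (EFin \o h).
  move=> mD; apply/measurable_EFinP; apply: measurable_funTS.
  exact: continuous_measurable_fun.
transitivity (\int[leb]_(u in `[(- r)%R, r]) (h u)%:E)%E.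
  rewrite [RHS]integral_mkcond; apply: eq_integral => u _.
  rewrite patchE/= mem_setE in_itv/= -ler_norml /tri /h.
  by case: ifPn => // _; rewrite mul0r.
rewrite (@itv_bndbnd_setU _ _ _ (BLeft 0)); last 2 first.
- by rewrite bnd_simp oppr_le0 ltW.
- by rewrite bnd_simp ltW.
rewrite integral_setU//=; last 2 first.
- apply: mh; exact: measurableU.
- rewrite disj_set2E; apply/eqP/seteqP; split=> // u []/=.
  by rewrite !in_itv/= => /andP[_ u0] /andP[/le_lt_trans/(_ u0)]; rewrite ltxx.
(* Adding the null point 0 makes the left piece the mirror image of [[0, r]]. *)
rewrite integral_itv_bndo_bndc; last exact: mh.
rewrite -{1}oppr0 integration_by_substitution_oppr; last 2 first.
- exact: ltW.
- exact: continuous_subspaceT.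
rewrite -integralD//; last 2 first.
- apply: continuous_compact_integrable; first exact: segment_compact.
  apply: continuous_subspaceT => u; apply: continuous_comp; first exact: opp_continuous.
  exact: ch.
- apply: continuous_compact_integrable; first exact: segment_compact.
  exact: continuous_subspaceT.
apply: eq_integral => u; rewrite inE/= in_itv/= => /andP[u0 ur].
rewrite /h/= -EFinD normrN ger0_norm//; congr EFin; ring.
Qed.

Lemma integral_tri_sin (r b : R) : 0 < r ->
  (\int[leb]_u (tri r u * sin (b * u))%:E = 0)%E.
Proof.
move=> r0; rewrite (integral_tri_mul (G := fun u => sin (b * u)))//; last first.
  move=> u; apply: (@continuous_comp _ _ _ ( *%R b) sin).
    exact: mulrl_continuous.
  exact: continuous_sin.
under eq_integral do rewrite mulrN sinN subrr mulr0.
exact: integral0.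
Qed.

Let continuous_aff (r : R) : continuous (fun u : R => 1 - u / r).
Proof.
move=> u; apply: cvgB; first exact: cvg_cst.
by apply: cvgMl; exact: cvg_id.
Qed.

Let continuous_cosM (b : R) : continuous (fun u : R => cos (b * u)).
Proof.
move=> u; apply: (@continuous_comp _ _ _ ( *%R b) cos).
  exact: mulrl_continuous.
exact: continuous_cos.
Qed.

(** The Fejer kernel in closed form, whose sign is visible from [cos <= 1]. *)
Lemma integral_tri_cosE (r b : R) : 0 < r -> b != 0 ->
  (\int[leb]_u (tri r u * cos (b * u))%:E =
   ((1 - cos (b * r)) * 2 / (r * b ^+ 2))%:E)%E.
Proof.
move=> r0 b0; rewrite (integral_tri_mul (G := fun u => cos (b * u)))//.
under eq_integral do rewrite mulrN cosN.
(* Antiderivative from one integration by parts, differentiating [1 - u / r]. *)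
pose F : R -> R := (fun u => (2 * (1 - u / r)) * (sin (b * u) / b) - 2 * (cos (b * u) / (r * b ^+ 2))).
have dF (u : R) : is_derive u 1 F ((1 - u / r) * (cos (b * u) + cos (b * u))).
  rewrite (_ : F = ((cst 2 - (2 / r) \*: id) * (b^-1 \*: (sin \o (b \*: id))) -
    (2 / (r * b ^+ 2)) \*: (cos \o (b \*: id)))%R); last first.
    apply/funext => v; rewrite /F !fctE/= /GRing.scale/=; field.
    by rewrite b0 gt_eqF.
  apply: is_derive_eq; rewrite !fctE/= /GRing.scale/=; field.
  by rewrite b0 gt_eqF.
rewrite (ge0_continuous_FTC2 _ _ dF)//.
- rewrite /F mulr0 sin0 cos0 divff ?gt_eqF//; congr EFin.
  by field; rewrite b0 gt_eqF.
- move=> u; apply: cvgM; first exact: continuous_aff.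
  by apply: cvgD; exact: continuous_cosM.
Qed.

(** On the support [|b u| <= 1], where the cosine is at least [cos 1], and the triangle has area
    [r]. *)
Lemma integral_tri_cos_ge (r b : R) : 0 < r -> `|b * r| <= 1 ->
  ((r * cos 1)%:E <= \int[leb]_u (tri r u * cos (b * u))%:E)%E.
Proof.
move=> r0 br1; rewrite (integral_tri_mul (G := fun u => cos (b * u)))//.
have -> : ((r * cos 1)%:E = \int[leb]_(u in `[0%R, r]) ((1 - u / r) * (2 * cos 1))%:E)%E.
  pose F : R -> R := fun u => (u - u ^+ 2 / (2 * r)) * (2 * cos 1).
  have dF (u : R) : is_derive u 1 F ((1 - u / r) * (2 * cos 1)).
    rewrite (_ : F = ((2 * cos 1) \*: (id - (2 * r)^-1 \*: (id * id)))%R); last first.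
      by apply/funext => v; rewrite /F !fctE/= /GRing.scale/=; field; rewrite gt_eqF.
    by apply: is_derive_eq; rewrite /= /GRing.scale/=; field; rewrite gt_eqF.
  rewrite (ge0_continuous_FTC2 _ _ dF)// /F.
  - congr EFin; rewrite expr0n/= mul0r subrr mul0r subr0; field; by rewrite gt_eqF.
  - move=> u; apply: cvgMl; exact: continuous_aff.
apply: ge0_le_integral => //.
- move=> u; rewrite /= in_itv/= => /andP[u0 ur]; rewrite lee_fin mulr_ge0//.
    by rewrite subr_ge0 ler_pdivrMr ?mul1r.
  by rewrite mulr_ge0// ltW// cos1_gt0.
- apply/measurable_EFinP; apply: measurable_funTS; apply: continuous_measurable_fun => u.
  apply: cvgMl; exact: continuous_aff.
- apply/measurable_EFinP; apply: measurable_funTS; apply: continuous_measurable_fun => u.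
  apply: cvgM; first exact: continuous_aff.
  apply: cvgD; first exact: continuous_cosM.
  under eq_fun do rewrite mulrN cosN.
  by rewrite mulrN cosN; exact: continuous_cosM.
move=> u; rewrite /= in_itv/= => /andP[u0 ur]; rewrite lee_fin ler_wpM2l//.
  by rewrite subr_ge0 ler_pdivrMr ?mul1r.
(* Evenness moves the argument into [[0, 1]], inside the interval [[0, pi]] where the cosine
   decreases. *)
suff : cos 1 <= cos `|b * u| by rewrite mulrN cosN cos_norm; lra.
have bu1 : `|b * u| <= 1.
  apply: le_trans br1; rewrite !normrM ler_wpM2l// !ger0_norm//; exact: ltW.
have pi1 : 1 <= pi :> R by have := pi_ge2 R; lra.
rewrite leNgt ltr_cos ?in_itv/= ?normr_ge0/= ?(le_trans bu1)// -?leNgt//.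
by rewrite ler01.
Qed.

Lemma integral_tri_cos_ge0 (r b : R) : 0 < r ->
  (0 <= \int[leb]_u (tri r u * cos (b * u))%:E)%E.
Proof.
(* The closed form divides by [b], so the case [b = 0] comes from the lower bound. *)
move=> r0; have [->|b0] := eqVneq b 0.
  apply: le_trans (integral_tri_cos_ge r0 _); last by rewrite mul0r normr0.
  by rewrite lee_fin mulr_ge0// ltW// cos1_gt0.
have c1 := cos_le1 (b * r); have b2 := sqr_ge0 b.
by rewrite integral_tri_cosE// lee_fin; apply: divr_ge0; apply: mulr_ge0 => //;
  lra.
Qed.

End triangle_kernel.

(** * Products of triangle functions on R^n *)

Lemma integrable_bounded_support {d : measure_display} {T : measurableType d}
    {R : realType} (mu : {measure set T -> \bar R}) (A : set T) (G : T -> R) :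
  measurable A -> mu A < +oo -> measurable_fun setT G ->
  (forall x, (`|G x| <= \1_A x)%R) -> mu.-integrable setT (EFin \o G).
Proof.
move=> mA Ay mG GA; apply: (@le_integrable _ _ _ _ _ _ _ (EFin \o \1_A)) => //.
- exact/measurable_EFinP.
- by move=> x _ /=; rewrite lee_fin (le_trans (GA x))// ler_norm.
apply/integrableP; split; first exact/measurable_EFinP.
under eq_integral do rewrite /= ger0_norm//.
by rewrite integral_indic// setIT.
Qed.

Lemma measurable_dotp {d : measure_display} {T : measurableType d}
    {R : realType} n (f g : T -> n.-tuple R) :
  measurable_fun setT f -> measurable_fun setT g ->
  measurable_fun setT (fun t => dotp (f t) (g t)).
Proof.
move=> mf mg; apply: measurable_sum => i; apply: measurable_funM.
  exact: (measurableT_comp (@measurable_tnth _ R n i) mf).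
exact: (measurableT_comp (@measurable_tnth _ R n i) mg).
Qed.

Lemma dotp_tcons {R : realType} n (z w : R * n.-tuple R) :
  dotp (tcons z) (tcons w) = (z.1 * w.1 + dotp z.2 w.2)%R.
Proof.
rewrite /dotp big_ord_recl !tnth0; congr (_ + _)%R; apply: eq_bigr => i _.
by rewrite !tnthS.
Qed.

Section product_kernel.
Context {R : realType}.
Local Notation leb := (@lebesgue_measure R).
Local Notation lebn := (lebesgue_Rn R).
Local Open Scope ring_scope.

Definition triN n (r : R) (x : n.-tuple R) : R := \prod_(i < n) tri r (tnth x i).

Lemma triN_tcons n (r : R) (z : R * n.-tuple R) :
  triN r (tcons z) = tri r z.1 * triN r z.2.
Proof.
rewrite /triN big_ord_recl !tnth0; congr (_ * _); apply: eq_bigr => i _.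
by rewrite !tnthS.
Qed.

Lemma triN_ge0 n (r : R) (x : n.-tuple R) : 0 < r -> 0 <= triN r x.
Proof. by move=> r0; apply: prodr_ge0 => i _; exact: tri_ge0. Qed.

Lemma measurable_triN n (r : R) : measurable_fun setT (@triN n r).
Proof.
apply: measurable_prod => i _.
exact: (measurableT_comp (measurable_tri r) (measurable_tnth i)).
Qed.

(** A single coordinate outside [[-r, r]] annihilates the product. This domination gives
    integrability and later confines the pairing to a cube. *)
Lemma triN_le_box n (r : R) (x : n.-tuple R) : 0 < r ->
  triN r x <= \1_(box `[- r, r]) x.
Proof.
move=> r0; rewrite indicE; have [_|/negP xr] := boolP (_ \in _).
  by apply: prodr_ile1 => i _; rewrite tri_ge0//= tri_le1.
have [i xi] : exists i, ~ (tnth x i \in `[- r, r]).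
  by apply/existsNP => xI; apply: xr; rewrite inE => i; exact: xI.
rewrite /triN (bigD1 i)//= /tri; case: ifPn; last by rewrite mul0r.
by move: xi; rewrite in_itv/= -ler_norml => /negP/negbTE ->.
Qed.

Lemma lebesgue_Rn_cube n (r : R) : 0 <= r ->
  lebn n (box `[- r, r]) = ((2 * r) ^+ n)%:E.
Proof.
move=> r0; apply: lebesgue_Rn_box => //.
rewrite lebesgue_measure_itv/= lte_fin; move: r0; rewrite le_eqVlt.
case/predU1P => [<-|r0]; first by rewrite oppr0 ltxx mulr0.
have -> : - r < r by lra.
by rewrite -EFinB; congr EFin; ring.
Qed.

Lemma integrable_triN_mul n (r : R) (G : n.-tuple R -> R) : 0 < r ->
  measurable_fun setT G -> (forall x, `|G x| <= 1) ->
  (lebn n).-integrable setT (EFin \o (fun x => triN r x * G x)).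
Proof.
move=> r0 mG G1; apply: (@integrable_bounded_support _ _ _ _ (box `[- r, r])).
- exact: measurable_box.
- by rewrite [ltLHS]lebesgue_Rn_cube ?ltry// ltW.
- by apply: measurable_funM => //; exact: measurable_triN.
move=> x; rewrite normrM ger0_norm ?triN_ge0//.
by rewrite (le_trans _ (triN_le_box x r0))// ler_piMr// triN_ge0.
Qed.

Lemma integrable_tri_mul (r : R) (G : R -> R) : 0 < r ->
  measurable_fun setT G -> (forall x, `|G x| <= 1) ->
  leb.-integrable setT (EFin \o (fun x => tri r x * G x)).
Proof.
move=> r0 mG G1; apply: (@integrable_bounded_support _ (measurableTypeR R) R leb `[- r, r]%classic
  (fun x => tri r x * G x)).
- exact: measurable_itv.
- by rewrite [ltLHS]lebesgue_measure_itv/=; case: ifPn => _; rewrite ?ltry// -EFinB ltry.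
- by apply: measurable_funM => //; exact: measurable_tri.
move=> x; rewrite normrM ger0_norm ?tri_ge0//.
rewrite indicE mem_setE in_itv/= -ler_norml /tri; case: ifPn => xr; last by rewrite mul0r.
rewrite mulr_ile1// ?normr_ge0//; last by rewrite gerBl divr_ge0// ltW.
by rewrite subr_ge0 ler_pdivrMr ?mul1r.
Qed.

(** The Fejer kernel as a real number, so that finite products can be formed; by [ktriE] nothing is
    lost in [fine] when [0 < r]. *)
Definition ktri (r b : R) : R := fine (\int[leb]_u (tri r u * cos (b * u))%:E)%E.

Lemma measurable_cosM (b : R) : measurable_fun setT (fun u : R => cos (b * u)).
Proof.
apply: continuous_measurable_fun => u.
apply: (@continuous_comp _ _ _ ( *%R b) cos); first exact: mulrl_continuous.
exact: continuous_cos.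
Qed.

Lemma ktriE (r b : R) : 0 < r ->
  (\int[leb]_u (tri r u * cos (b * u))%:E = (ktri r b)%:E)%E.
Proof.
move=> r0; rewrite /ktri fineK//.
apply: integrable_fin_num => //; apply: integrable_tri_mul => //.
  exact: measurable_cosM.
by move=> x; exact: cos_max.
Qed.

Lemma ktri_ge0 (r b : R) : 0 < r -> 0 <= ktri r b.
Proof. by move=> r0; rewrite -lee_fin -ktriE// integral_tri_cos_ge0. Qed.

Lemma ktri_ge (r b : R) : 0 < r -> `|b * r| <= 1 -> r * cos 1 <= ktri r b.
Proof. by move=> r0 br; rewrite -lee_fin -ktriE// integral_tri_cos_ge. Qed.

Let measurable_trigM n (c : R) (x : n.-tuple R) (T : R -> R) : continuous T ->
  measurable_fun setT (fun y : n.-tuple R => T (c * dotp y x)).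
Proof.
move=> cT; apply: (measurableT_comp (continuous_measurable_fun cT)).
by apply: measurable_funM => //; exact: measurable_dotp.
Qed.

(** The addition formulas mix cosine and sine, so both integrals go through one induction on the
    dimension; the sine integrals vanish by oddness. *)
Lemma integral_triN_trig n (r c : R) (x : n.-tuple R) : 0 < r ->
  (\int[lebn n]_y (triN r y * cos (c * dotp y x))%:E =
    (\prod_(i < n) ktri r (c * tnth x i))%:E)%E /\
  (\int[lebn n]_y (triN r y * sin (c * dotp y x))%:E = 0)%E.
Proof.
move=> r0; elim: n x => [|n IHn] x.
  have triN0 (y : 0.-tuple R) : triN r y = 1 by rewrite /triN big_ord0.
  have dotp0 (y : 0.-tuple R) : dotp y x = 0 by rewrite /dotp big_ord0.
  under eq_integral do rewrite triN0 dotp0 mulr0 cos0 mulr1.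
  under [X in _ /\ X = _]eq_integral do rewrite triN0 dotp0 mulr0 sin0 mulr0.
  rewrite integral0 big_ord0 integral_cst// mul1e; split => //.
  exact: diracT.
pose z := (thead x, [tuple of behead x] : n.-tuple R).
have xz : x = tcons z by rewrite [LHS]tuple_eta; apply/val_inj.
have [IHc IHs] := IHn z.2; set P := \prod_(i < n) _ in IHc.
have mcos := measurable_trigM c z.2 (@continuous_cos R).
have msin := measurable_trigM c z.2 (@continuous_sin R).
have iC := integrable_triN_mul r0 mcos (fun y => cos_max _).
have iS := integrable_triN_mul r0 msin (fun y => sin_max _).
(* With the first coordinate fixed, the addition formulas leave a combination of cosine and sine in
   the others; the induction hypothesis keeps only the cosine term. *)
have inner (al be : R) : (\int[lebn n]_y (al * (triN r y * cos (c * dotp y z.2)) +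
    be * (triN r y * sin (c * dotp y z.2)))%:E = (al * P)%:E)%E.
  under eq_integral do rewrite EFinD (EFinM al) (EFinM be).
  rewrite integralD//; last 2 first.
  - exact: (integrableZl measurableT al iC).
  - exact: (integrableZl measurableT be iS).
  by rewrite !integralZl// IHc IHs mule0 adde0.
have iT (T : R -> R) : continuous T -> (forall u, `|T u| <= 1) ->
    (\int[lebn n.+1]_y (triN r y * T (c * dotp y x))%:E =
     \int[leb]_u \int[lebn n]_y
       (tri r u * triN r y * T (c * z.1 * u + c * dotp y z.2))%:E)%E.
  move=> cT T1; rewrite integral_lebesgue_RnS; last first.
    exact: (integrable_triN_mul r0 (measurable_trigM c x cT)).
  apply: eq_integral => u _; apply: eq_integral => y _.
  rewrite triN_tcons xz dotp_tcons/=; congr (_ * T _)%:E; ring.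
split.
  rewrite (iT _ (@continuous_cos R) (@cos_max R)).
  transitivity (\int[leb]_u ((tri r u * cos (c * z.1 * u))%:E * P%:E))%E.
    apply: eq_integral => u _.
    rewrite -EFinM -(inner _ (- (tri r u * sin (c * z.1 * u)))).
    by apply: eq_integral => y _; rewrite cosD; congr EFin; ring.
  rewrite integralZr//; last first.
    apply: integrable_tri_mul => //; first exact: measurable_cosM.
    by move=> u; exact: cos_max.
  rewrite ktriE// -EFinM big_ord_recl xz tnth0; congr (_ * _)%:E.
  by apply: eq_bigr => i _; rewrite tnthS.
rewrite (iT _ (@continuous_sin R) (@sin_max R)).
transitivity (\int[leb]_u ((tri r u * sin (c * z.1 * u))%:E * P%:E))%E.
  apply: eq_integral => u _.
  rewrite -EFinM -(inner _ (tri r u * cos (c * z.1 * u))).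
  by apply: eq_integral => y _; rewrite sinD; congr EFin; ring.
rewrite integralZr//; last first.
  apply: integrable_tri_mul => //; last by move=> u; exact: sin_max.
  apply: continuous_measurable_fun => u.
  apply: (@continuous_comp _ _ _ ( *%R (c * z.1)) sin).
    exact: mulrl_continuous.
  exact: continuous_sin.
by rewrite integral_tri_sin// mul0e.
Qed.

End product_kernel.

(** * Lower bound for the Fourier transform *)

(** Tonelli handles the positive and negative parts separately, and their difference stays
    measurable without any integrability. *)
Lemma measurable_fun_integral {d1 d2 : measure_display}
    {T1 : measurableType d1} {T2 : measurableType d2} {R : realType}
    (m2 : {sigma_finite_measure set T2 -> \bar R}) (F : T1 * T2 -> \bar R) :
  measurable_fun setT F ->
  measurable_fun setT (fun x => \int[m2]_y F (x, y)).
Proof.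
move=> mF.
rewrite (_ : (fun x => _) = (fun x => \int[m2]_y (F^\+ (x, y))) \-
    (fun x => \int[m2]_y (F^\- (x, y)))); last first.
  apply/funext => x; rewrite [LHS]integralE.
  under eq_integral do rewrite funepos_comp/=.
  by under [X in _ - X = _]eq_integral do rewrite funeneg_comp/=.
apply: emeasurable_funB.
  by apply: measurable_fun_fubini_tonelli_F => //; exact: measurable_funepos.
by apply: measurable_fun_fubini_tonelli_F => //; exact: measurable_funeneg.
Qed.

Section fourier_lower_bound.
Context {R : realType} {n : nat}.
Local Notation lebn := (lebesgue_Rn R n).
Local Notation Rn := (n.-tuple R).

(** The real part of the transform of a real function; the minus sign of the phase is absorbed by
    the evenness of the cosine. *)
Definition fourier_cos (f : Rn -> R) (xi : Rn) : R :=
  (\int[lebn]_x (f x * cos (2 * pi * dotp xi x)))%R.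

Lemma cabs_fourier (f : Rn -> R) (xi : Rn) :
  cabs (fourier (fun x => (f x)%:C%C) xi) =
  Num.sqrt (fourier_cos f xi ^+ 2 +
    (\int[lebn]_x (- (f x * sin (2 * pi * dotp xi x))))%R ^+ 2)%R.
Proof.
rewrite /cabs /fourier /Cintegral /= /fourier_cos.
by congr (Num.sqrt (_ ^+ 2 + _ ^+ 2))%R; apply: eq_Rintegral => x _ /=;
  rewrite ?cosN ?sinN; ring.
Qed.

Lemma measurable_cabs_fourier (f : Rn -> R) : measurable_fun setT f ->
  measurable_fun setT (fun xi => cabs (fourier (fun x => (f x)%:C%C) xi)).
Proof.
move=> mf; under eq_fun do rewrite cabs_fourier.
have mT (T : R -> R) : continuous T -> measurable_fun setT
    (fun z : Rn * Rn => (f z.2 * T (2 * pi * dotp z.1 z.2))%:E).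
  move=> cT; apply/measurable_EFinP; apply: measurable_funM.
    exact: (measurableT_comp mf).
  apply: (measurableT_comp (continuous_measurable_fun cT)).
  by apply: measurable_funM => //; exact: measurable_dotp.
have mS : measurable_fun setT
    (fun z : Rn * Rn => (- (f z.2 * sin (2 * pi * dotp z.1 z.2)))%:E).
  apply/measurable_EFinP; apply: measurable_funN.
  by have /measurable_EFinP := mT _ (@continuous_sin R).
apply: (measurableT_comp (continuous_measurable_fun (@sqrt_continuous R))).
apply: measurable_funD; apply: measurable_funX; apply: measurableT_comp => //.
- exact: (measurable_fun_integral lebn (mT _ (@continuous_cos R))).
- exact: (measurable_fun_integral lebn mS).
Qed.

Lemma measurable_fourier_cos (f : Rn -> R) : measurable_fun setT f ->
  measurable_fun setT (fourier_cos f).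
Proof.
move=> mf; apply: measurableT_comp => //.
apply: (measurable_fun_integral lebn
  (F := fun z : Rn * Rn => (f z.2 * cos (2 * pi * dotp z.1 z.2))%:E)).
apply/measurable_EFinP; apply: measurable_funM.
  exact: (measurableT_comp mf).
apply: (measurableT_comp (continuous_measurable_fun (@continuous_cos R))).
by apply: measurable_funM => //; exact: measurable_dotp.
Qed.

Lemma fourier_cos_le_cabs (f : Rn -> R) (xi : Rn) :
  (`|fourier_cos f xi| <= cabs (fourier (fun x => (f x)%:C%C) xi))%R.
Proof.
by rewrite cabs_fourier -sqrtr_sqr ler_wsqrtr// lerDl sqr_ge0.
Qed.

Variable f : Rn -> R.
Hypothesis intf : lebn.-integrable setT (EFin \o f).
Hypothesis f0 : forall x, (0 <= f x)%R.

Let mf : measurable_fun setT f.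
Proof. by have /measurable_int/measurable_EFinP := intf. Qed.

(** The multiplication formula, moving the transform from [f] to the kernel by Fubini. *)
Lemma integral_triN_fourier (r : R) : (0 < r)%R ->
  \int[lebn]_xi (triN r xi * fourier_cos f xi)%:E =
  \int[lebn]_x (f x * \prod_(i < n) ktri r (2 * pi * tnth x i))%:E.
Proof.
move=> r0; pose G (z : Rn * Rn) :=
  (triN r z.1 * (f z.2 * cos (2 * pi * dotp z.1 z.2)))%:E.
have mcos : measurable_fun setT (fun z : Rn * Rn => cos (2 * pi * dotp z.1 z.2)).
  apply: (measurableT_comp (continuous_measurable_fun (@continuous_cos R))).
  by apply: measurable_funM => //; exact: measurable_dotp.
have mG : measurable_fun setT G.
  apply/measurable_EFinP; apply: measurable_funM.
    exact: (measurableT_comp (measurable_triN r)).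
  by apply: measurable_funM => //; exact: (measurableT_comp mf).
have mcosx xi : measurable_fun setT (fun x : Rn => cos (2 * pi * dotp xi x)).
  exact: (measurableT_comp mcos (measurable_pair1 xi)).
have intfc xi : lebn.-integrable setT
    (fun x => (f x * cos (2 * pi * dotp xi x))%:E).
  apply: (@le_integrable _ _ _ _ _ measurableT _ (EFin \o f)) => //.
    by apply/measurable_EFinP; exact: measurable_funM.
  move=> x _; rewrite /= lee_fin normrM ler_piMr//; exact: cos_max.
have intG : (lebn \x lebn).-integrable setT G.
  apply/(integrable12ltyP _ _ mG).
  (* The inner integral of [|G|] is at most [m * triN r xi], which is integrable in [xi]. *)
  pose m : R := (\int[lebn]_x f x)%R.
  have mE : \int[lebn]_x (f x)%:E = m%:E.
    by rewrite /m /Rintegral fineK//; exact: integrable_fin_num.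
  have m0 : (0 <= m)%R by exact: Rintegral_ge0.
  (* The factor 1 plays the bounded function of [integrable_triN_mul]. *)
  have iT : lebn.-integrable setT (fun xi => (triN r xi * 1)%:E).
    by apply: integrable_triN_mul => // x; rewrite normr1.
  have /integrableP[_] := integrableZl measurableT m iT.
  apply: le_lt_trans; apply: ge0_le_integral => //.
  - by move=> *; apply: integral_ge0.
  - apply: (measurable_fun_fubini_tonelli_F (abse \o G)).
      exact: (measurableT_comp _ mG).
    by move=> z; exact: abse_ge0.
  - apply: measurableT_comp => //; apply/measurable_EFinP.
    apply: measurable_funM => //; apply: measurable_funM => //.
    exact: measurable_triN.
  move=> xi _; rewrite mulr1 -EFinM abse_EFin.
  rewrite ger0_norm ?mulr_ge0 ?triN_ge0// mulrC EFinM -mE.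
  rewrite -ge0_integralZl//; last 3 first.
  - by apply/measurable_EFinP.
  - by move=> *; rewrite lee_fin.
  - by rewrite lee_fin triN_ge0.
  apply: ge0_le_integral => //.
  - apply: measurableT_comp => //; apply: (measurableT_comp mG).
    exact: measurable_pair1.
  - by apply/measurable_EFinP; apply: measurable_funM.
  move=> x _; rewrite /G/= lee_fin !normrM ger0_norm ?triN_ge0//.
  rewrite ler_wpM2l ?triN_ge0// ger0_norm// ler_piMr//; exact: cos_max.
transitivity (\int[lebn]_xi \int[lebn]_x G (xi, x)).
  apply: eq_integral => xi _; rewrite /G/=.
  under [RHS]eq_integral do rewrite EFinM.
  rewrite integralZl// EFinM /fourier_cos /Rintegral fineK//.
  exact: integrable_fin_num.
rewrite (Fubini intG); apply: eq_integral => x _; rewrite /G/=.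
under eq_integral do rewrite mulrCA EFinM.
rewrite integralZl//; last first.
  apply: integrable_triN_mul => //; last by move=> xi; exact: cos_max.
  exact: (measurableT_comp mcos (measurable_pair2 x)).
by rewrite (integral_triN_trig _ _ r0).1.
Qed.

(** On the small box every phase [2 pi x_i r] lies in [[0, 1]], so the product of Fejer kernels is
    at least [(r cos 1)^n]. The kernels and [f] being nonnegative, the box may then be enlarged to
    the whole space. *)
Lemma integral_cabs_fourier_ge (r : R) : (0 < r)%R ->
  ((r * cos 1) ^+ n)%:E * \int[lebn]_(x in box `]0%R, (2 * pi * r)^-1%R]%classic) (f x)%:E <=
  \int[lebn]_(xi in box `[(- r)%R, r]%classic) (cabs (fourier (fun x => (f x)%:C%C) xi))%:E.
Proof.
move=> r0; set B := box _; set Q := box _.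
have mB : measurable B by exact: measurable_box.
have mQ : measurable Q by exact: measurable_box.
have pr0 : (0 < 2 * pi * r)%R by rewrite !mulr_gt0// pi_gt0.
set P := fun x : Rn => (\prod_(i < n) ktri r (2 * pi * tnth x i))%R.
have P0 x : (0 <= P x)%R by apply: prodr_ge0 => i _; exact: ktri_ge0.
have PB x : B x -> ((r * cos 1) ^+ n <= P x)%R.
  move=> Bx; rewrite -[X in (_ ^+ X)%R]card_ord -prodr_const.
  apply: ler_prod => i _; rewrite mulr_ge0 ?(ltW r0) ?(ltW (cos1_gt0 _))//=.
  apply: ktri_ge => //; have := Bx i; rewrite /= in_itv/= => /andP[x0 xr].
  have -> : (2 * pi * tnth x i * r = tnth x i * (2 * pi * r))%R by ring.
  rewrite ger0_norm; last by rewrite mulr_ge0// ltW.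
  by rewrite -ler_pdivlMr// mul1r.
(* Measurability is read off from [P] being a parameter integral of the kernel. *)
have mP : measurable_fun setT P.
  apply/measurable_EFinP.
  pose G (z : Rn * Rn) := (triN r z.2 * cos (2 * pi * dotp z.2 z.1))%:E.
  rewrite (_ : EFin \o P = fun x => \int[lebn]_y G (x, y)); last first.
    by apply/funext => x; rewrite /G/= (integral_triN_trig _ _ r0).1.
  apply: measurable_fun_integral; apply/measurable_EFinP; apply: measurable_funM.
    exact: (measurableT_comp (measurable_triN r)).
  apply: (measurableT_comp (continuous_measurable_fun (@continuous_cos R))).
  by apply: measurable_funM => //; exact: measurable_dotp.
apply: (@le_trans _ _ (\int[lebn]_x (f x * P x)%:E)).
  rewrite -ge0_integralZl//; last 3 first.
  - by apply/measurable_EFinP; exact: measurable_funTS.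
  - by move=> *; rewrite lee_fin.
  - by rewrite lee_fin exprn_ge0// mulr_ge0 ?(ltW r0) ?(ltW (cos1_gt0 _)).
  apply: (@le_trans _ _ (\int[lebn]_(x in B) (f x * P x)%:E)).
    apply: ge0_le_integral => //.
    - move=> x Bx; rewrite -EFinM lee_fin mulr_ge0// exprn_ge0//.
      by rewrite mulr_ge0 ?(ltW r0) ?(ltW (cos1_gt0 _)).
    - apply/measurable_EFinP; apply: measurable_funTS; exact: measurable_funM.
    - apply/measurable_EFinP; apply: measurable_funTS; exact: measurable_funM.
    by move=> x Bx; rewrite -EFinM lee_fin mulrC ler_wpM2l// PB.
  apply: ge0_subset_integral => //.
    by apply/measurable_EFinP; exact: measurable_funM.
  by move=> x _; rewrite lee_fin mulr_ge0.
rewrite -integral_triN_fourier// [leRHS]integral_mkcond.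
have mT : measurable_fun setT (fun xi => (triN r xi * fourier_cos f xi)%:E).
  apply/measurable_EFinP; apply: measurable_funM; first exact: measurable_triN.
  exact: measurable_fourier_cos.
apply: le_trans (lee_abs _) _; apply: le_trans (le_abse_integral _ _ _) _ => //.
apply: ge0_le_integral => //.
- exact: measurableT_comp.
- apply/(measurable_restrictT _ mQ); apply: measurable_funTS.
  apply/measurable_EFinP; exact: (measurable_cabs_fourier mf).
move=> xi _; rewrite patchE /= normrM ger0_norm ?triN_ge0//.
(* On [Q] the weight is at most 1; off [Q] it is squeezed to 0. *)
have := triN_le_box xi r0; rewrite indicE -/Q; case: ifPn => _ xi1; rewrite lee_fin.
  by apply: le_trans (fourier_cos_le_cabs f xi); rewrite ler_piMl.
rewrite (_ : triN r xi = 0)%R ?mul0r//; apply/eqP; rewrite eq_le xi1.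
exact: triN_ge0.
Qed.

End fourier_lower_bound.

(** * Radial functions *)

Lemma exists_root {R : realType} n (t : R) : (0 < n)%N -> (0 < t)%R ->
  exists2 s : R, (0 < s)%R & (s ^+ n = t)%R.
Proof.
move=> n0 t0; exists (t `^ n%:R^-1)%R; first exact: powR_gt0.
rewrite -powR_mulrn ?powR_ge0// -powRrM mulVf ?powRr1 ?ltW//.
by rewrite pnatr_eq0 -lt0n.
Qed.

Section enorm_facts.
Context {R : realType} {n : nat}.
Implicit Type x : n.-tuple R.
Local Open Scope ring_scope.

Lemma enorm_ge0 x : 0 <= enorm x.
Proof. exact: sqrtr_ge0. Qed.

Lemma tnth_le_enorm x i : `|tnth x i| <= enorm x.
Proof.
rewrite -sqrtr_sqr ler_wsqrtr// /dotp (bigD1 i)//= -expr2 lerDl.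
by apply: sumr_ge0 => j _; rewrite -expr2 sqr_ge0.
Qed.

(** The crude factor [n] in place of its square root suffices, only constants being affected. *)
Lemma enorm_box (r : R) x : (0 < n)%N -> box `]0, r]%classic x ->
  0 < enorm x <= n%:R * r.
Proof.
move=> n0 xr; pose i0 := Ordinal n0.
have xP i : 0 < tnth x i <= r by have := xr i; rewrite /= in_itv.
have r0 : 0 < r by case/andP: (xP i0) => /lt_le_trans; exact.
apply/andP; split.
  apply: lt_le_trans (tnth_le_enorm x i0); rewrite normr_gt0 gt_eqF//.
  by case/andP: (xP i0).
have nr0 : 0 <= n%:R * r by rewrite mulr_ge0// ltW.
rewrite -(ger0_norm nr0) -sqrtr_sqr ler_wsqrtr//.
apply: (@le_trans _ _ (\sum_(i < n) r ^+ 2)).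
  apply: ler_sum => i _; have /andP[x0 xr'] := xP i.
  by rewrite expr2 ler_pM// ltW.
rewrite sumr_const card_ord exprMn -[leLHS]mulr_natl ler_wpM2r ?sqr_ge0//.
by rewrite expr2 -natrM ler_nat leq_pmulr.
Qed.

Lemma measurable_enorm : measurable_fun setT (@enorm R n).
Proof.
apply: (measurableT_comp (continuous_measurable_fun (@sqrt_continuous R))).
exact: measurable_dotp.
Qed.

End enorm_facts.

Section radial.
Context {R : realType} {n : nat} (H : R -> R).
Hypothesis n_gt0 : (0 < n)%N.
Hypothesis mH : measurable_fun setT H.
Hypothesis H0 : forall t, (0 <= H t)%R.
Hypothesis H_ni : forall s t, (0 < s)%R -> (s <= t)%R -> (H t <= H s)%R.
Local Notation lebn := (lebesgue_Rn R n).
Local Notation leb := (@lebesgue_measure R).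

(* The factor [pi >= 2] puts the ball [pi |x| < tau] inside a cube of side
   [tau], and it makes [radialK * a ^+ n >= t^-1] for the cube of side
   [a = (2 pi r)^-1] on which the kernel of parameter [r] is bounded below. *)
Definition radial (x : n.-tuple R) : R := H ((pi * enorm x) ^+ n)%R.

Let radial_ge0 x : (0 <= radial x)%R. Proof. exact: H0. Qed.

Lemma measurable_radial : measurable_fun setT radial.
Proof.
apply: (measurableT_comp mH); apply: measurable_funX.
by apply: measurable_funM => //; exact: measurable_enorm.
Qed.

(** Monotonicity of [H] turns the strict inequality into [pi |x| < tau]; the cube reached has volume
    exactly [t]. *)
Lemma radial_gt_cube (t tau : R) x : (0 < t)%R -> (0 < tau)%R ->
  (tau ^+ n = t)%R -> (H t < radial x)%R ->
  box `[(- (tau / 2))%R, (tau / 2)%R]%classic x.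
Proof.
move=> t0 tau0 taun Ht i; rewrite /= in_itv/= -ler_norml.
apply: le_trans (tnth_le_enorm x i) _.
have : ((pi * enorm x) ^+ n < tau ^+ n)%R.
  by rewrite ltNge taun; apply: contraTN Ht => tx; rewrite -leNgt H_ni.
rewrite ltr_pXn2r// ?nnegrE ?mulr_ge0 ?pi_ge0 ?enorm_ge0 ?(ltW tau0)// => xtau.
have := pi_ge2 R; have := enorm_ge0 x => x0 pi2.
have : (2 * enorm x <= pi * enorm x)%R by rewrite ler_wpM2r.
lra.
Qed.

Lemma rearr_radial (t : R) : (0 < t)%R ->
  rearr lebn setT (EFin \o radial) t <= (H t)%:E.
Proof.
move=> t0; apply: rearr_le => //.
have [tau tau0 taun] := exists_root n_gt0 t0.
have tau2 : (0 <= tau / 2)%R by rewrite divr_ge0// ltW.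
apply: (@le_trans _ _ (lebn (box `[(- (tau / 2))%R, (tau / 2)%R]%classic))).
  apply: le_measure; rewrite ?inE//; last 2 first.
  - exact: measurable_box.
  - move=> x [_]/=; rewrite lte_fin ger0_norm// => /radial_gt_cube; exact.
  apply: measurable_lte => //; apply: measurableT_comp => //.
  by apply/measurable_EFinP; exact: measurable_radial.
rewrite [leLHS]lebesgue_Rn_cube// lee_fin -taun.
by rewrite (_ : 2 * (tau / 2) = tau)%R//; field.
Qed.

(** [radial] lives on a cube of volume [k], so Hardy--Littlewood and [rearr_radial] bound its
    integral by that of [H] over []0, k[]. *)
Lemma integrable_radial (k : R) : (0 < k)%R ->
  (forall t, (k <= t)%R -> H t = 0%R) ->
  \int[leb]_(t in `]0%R, k[) (H t)%:E < +oo ->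
  lebn.-integrable setT (EFin \o radial).
Proof.
move=> k0 Hk Hy; have mf := measurable_radial.
apply/integrableP; split; first exact/measurable_EFinP.
apply: le_lt_trans Hy.
have [kap kap0 kapn] := exists_root n_gt0 k0.
have kap2 : (0 <= kap / 2)%R by rewrite divr_ge0// ltW.
pose B : set (n.-tuple R) := box `[(- (kap / 2))%R, (kap / 2)%R]%classic.
have mB : measurable B by exact: measurable_box.
(* Off the cube, [radial x] cannot exceed [H k = 0]. *)
have -> : \int[lebn]_x `|(EFin \o radial) x| = \int[lebn]_(x in B) (EFin \o radial) x.
  rewrite [RHS]integral_mkcond; apply: eq_integral => x _; rewrite patchE.
  rewrite gee0_abs ?lee_fin//; case: ifPn => // /negP xB.
  congr EFin; apply/eqP; rewrite eq_le H0 andbT leNgt; apply/negP => fx.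
  apply: xB; rewrite inE; apply: (radial_gt_cube k0) => //.
  by rewrite Hk.
apply: (@le_trans _ _
    (\int[leb]_(s in `]0%R, k[) rearr lebn setT (EFin \o radial) s)).
  apply: integral_le_rearr => //.
  - exact/measurable_EFinP.
  - by move=> *; rewrite lee_fin.
  - exact: ltW.
  rewrite [leLHS]lebesgue_Rn_cube// lee_fin -kapn.
  by rewrite (_ : 2 * (kap / 2) = kap)%R//; field.
apply: ge0_le_integral => //.
- by move=> *; exact: rearr_ge0.
- by apply: measurable_rearr => //; exact: interval_is_interval.
- by apply/measurable_EFinP; exact: measurable_funTS.
by move=> s; rewrite /= in_itv/= => /andP[s0 _]; exact: rearr_radial.
Qed.

(** On the cube []0, rho]^n] the argument [(pi |x|)^n] of [H] is at most [radialK * rho^n]. *)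
Definition radialK : R := ((pi * n%:R) ^+ n)%R.

Lemma radialK_gt0 : (0 < radialK)%R.
Proof. by rewrite exprn_gt0// mulr_gt0 ?pi_gt0// ltr0n. Qed.

(** Compare layers: if [H s > l] and [s = radialK * rho^n], then [radial >= l] on the cube []0,
    rho]^n], whose volume is [s / radialK]. *)
Lemma integral_radial_ge (a : R) : (0 < a)%R ->
  \int[leb]_(s in `]0%R, (radialK * a ^+ n)%R[) (H s)%:E <=
  radialK%:E * \int[lebn]_(x in box `]0%R, a]%classic) (radial x)%:E.
Proof.
move=> a0; have mf := measurable_radial.
have pn0 : (0 < pi * n%:R :> R)%R by rewrite mulr_gt0 ?pi_gt0// ltr0n.
set Q := box _; have mQ : measurable Q by exact: measurable_box.
have boxE (r : R) : (0 < r)%R -> lebn (box `]0%R, r]%classic) = (r ^+ n)%:E.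
  move=> r0; apply: lebesgue_Rn_box => //.
  by rewrite lebesgue_measure_itv/= lte_fin r0 sube0.
have K0 := radialK_gt0.
apply: integral_le_layers => //.
- by apply/measurable_EFinP; exact: measurable_funTS.
- by apply/measurable_EFinP; exact: measurable_funTS.
- by move=> *; rewrite lee_fin.
- by move=> *; rewrite lee_fin.
- exact: ltW.
move=> l l0; set S := Q `&` _.
have mS : measurable S.
  by apply: measurable_lee => //; apply/measurable_EFinP; exact: measurable_funTS.
have [m mE] : exists m : R, lebn S = m%:E.
  exists (fine (lebn S)); rewrite fineK// ge0_fin_numE//.
  apply: (@le_lt_trans _ _ (lebn Q)); last by rewrite [ltLHS]boxE// ltry.
  by apply: le_measure; rewrite ?inE// => x [].
have m0 : (0 <= m)%R by rewrite -lee_fin -mE.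
apply: (@le_trans _ _ (radialK * m)%:E); last by rewrite EFinM -mE.
apply: (@le_trans _ _ (leb `]0%R, (radialK * m)%R]%classic)); last first.
  rewrite lebesgue_measure_itv/= lte_fin; case: ifPn => _; rewrite ?sube0//.
  by rewrite lee_fin mulr_ge0// ltW.
apply: le_measure; rewrite ?inE//.
  by apply: measurable_lte => //; apply/measurable_EFinP; exact: measurable_funTS.
move=> s [/=]; rewrite !in_itv/= lte_fin => /andP[s0 sa] lH; rewrite s0/=.
have [sig sig0 sign] := exists_root n_gt0 s0.
(* Chosen so that [radialK * rho^n = s]; then [rho <= a], and the cube stays inside [Q]. *)
pose rho := (sig / (pi * n%:R))%R.
have rho0 : (0 < rho)%R by rewrite divr_gt0.
have rhos : (radialK * rho ^+ n = s)%R.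
  by rewrite /radialK -exprMn mulrC divfK ?gt_eqF.
rewrite -rhos ler_wpM2l ?(ltW K0)// -lee_fin -(boxE _ rho0) -mE.
apply: le_measure; rewrite ?inE//; first exact: measurable_box.
have rhoa : (rho <= a)%R.
  move: sa; rewrite -rhos ltr_pM2l// ltr_pXn2r ?nnegrE ?(ltW rho0) ?(ltW a0)//.
  exact: ltW.
move=> x xrho; split.
  by move=> i; have := xrho i; rewrite /= !in_itv/= => /andP[-> /le_trans]; apply.
rewrite /= lee_fin; apply: le_trans (ltW lH) _.
have /andP[x0 xr] := enorm_box n_gt0 xrho.
apply: H_ni; first by rewrite exprn_gt0// mulr_gt0// pi_gt0.
have px0 : (0 <= pi * enorm x)%R by rewrite mulr_ge0 ?pi_ge0// ltW.
have pr0 : (0 <= pi * n%:R * rho)%R by rewrite mulr_ge0// ltW.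
rewrite -rhos /radialK -exprMn lerXn2r ?nnegrE// -[leRHS]mulrA.
by apply: ler_wpM2l => //; exact: pi_ge0.
Qed.

(** Combines the lower bound on the box of side [a] with Hardy--Littlewood for the transform on the
    cube of volume [t]. *)
Lemma opU_le_avg_fourier (t : R) : (0 < t)%R ->
  lebn.-integrable setT (EFin \o radial) ->
  opU (EFin \o H) t <= (radialK * (2 / cos 1) ^+ n)%:E * ((t^-1)%:E *
    \int[leb]_(s in `]0%R, t[) rearr lebn setT
      (fun xi => (cabs (fourier (fun x => (radial x)%:C%C) xi))%:E) s).
Proof.
move=> t0 intf; have K0 := radialK_gt0; have c1 := @cos1_gt0 R.
have mf := measurable_radial.
have [tau tau0 taun] := exists_root n_gt0 t0.
(* The frequency cube [[-r, r]^n] gets volume [t], and [a] is the side of the matching box in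
   space. *)
pose r := (tau / 2)%R; have r0 : (0 < r)%R by rewrite divr_gt0.
pose a := ((2 * pi * r)^-1)%R.
have a0 : (0 < a)%R by rewrite invr_gt0 !mulr_gt0// pi_gt0.
have le1 : opU (EFin \o H) t <= radialK%:E *
    \int[lebn]_(x in box `]0%R, a]%classic) (radial x)%:E.
  apply: le_trans (integral_radial_ge a0); apply: ge0_subset_integral => //.
  - by apply/measurable_EFinP; exact: measurable_funTS.
  - by move=> *; rewrite lee_fin.
  (* Here [radialK * a^n] equals [n^n / t], which is at least [1 / t]. *)
  apply: subset_itvl; rewrite bnd_simp /radialK -exprMn /a /r.
  have -> : (pi * n%:R * (2 * pi * (tau / 2))^-1 = n%:R / tau :> R)%R.
    by move: pi (@pi_gt0 R) => p p0; field; rewrite !gt_eqF.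
  rewrite expr_div_n taun ler_peMl ?invr_ge0 ?(ltW t0)//.
  by rewrite exprn_ege1// ler1n.
apply: le_trans le1 _.
set X := \int[lebn]_(x in _) _; set Y := \int[leb]_(s in _) _.
have le2 : ((r * cos 1) ^+ n)%:E * X <= Y.
  apply: le_trans (integral_cabs_fourier_ge intf (fun x => H0 _) r0) _.
  apply: integral_le_rearr => //.
  - by apply/measurable_EFinP; exact: measurable_cabs_fourier.
  - by move=> xi _; rewrite lee_fin (le_trans _ (fourier_cos_le_cabs _ _)).
  - exact: measurable_box.
  - exact: ltW.
  rewrite [leLHS]lebesgue_Rn_cube ?(ltW r0)// lee_fin -taun.
  by rewrite (_ : 2 * r = tau)%R// /r; field.
have rc0 : (0 < (r * cos 1) ^+ n)%R by rewrite exprn_gt0// mulr_gt0.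
rewrite muleA -EFinM.
(* The powers of 2 match because [t = (2 r)^n]. *)
have -> : (radialK * (2 / cos 1) ^+ n / t = radialK * ((r * cos 1) ^+ n)^-1)%R.
  rewrite -taun -mulrA; congr (_ * _)%R; rewrite -expr_div_n -exprVn.
  by congr (_ ^+ _)%R; rewrite /r; field; rewrite !gt_eqF.
rewrite EFinM -muleA lee_wpmul2l ?lee_fin ?(ltW K0)//.
by rewrite lee_pdivlMl.
Qed.

End radial.

(** * Rearrangement-invariant norms *)

Section ri_norm_facts.
Context {d : measure_display} {T : measurableType d} {R : realType}.
Variables (mu : set T -> \bar R) (Omega : set T) (rho : (T -> \bar R) -> \bar R).
Hypothesis ri_rho : ri_norm mu Omega rho.

(* Fatou property for the sequence f, g, g, g, ... *)
Lemma ri_norm_le (f g : T -> \bar R) : Mplus Omega f -> Mplus Omega g ->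
  (forall x, Omega x -> f x <= g x) -> rho f <= rho g.
Proof.
move=> Mf Mg fg; pose f_ (k : nat) := if k is 0%N then f else g.
have [||x Ox k l kl|x Ox|+ _] := @ri_fatou _ _ _ _ _ _ ri_rho f_ g; last first.
- by move=> /(_ 0%N 1%N isT).
- by apply: cvg_near_cst; exists 1%N => // -[].
- by move: k l kl => [|k] [|l]//= _; exact: fg.
- exact: Mg.
- by case.
Qed.

End ri_norm_facts.

Section half_line_operators.
Context {R : realType}.
Implicit Types h g : R -> \bar R.
Local Notation leb := (@lebesgue_measure R).

Lemma Mplus_rearr {d : measure_display} {T : measurableType d}
    (mu : {measure set T -> \bar R}) (Omega : set T) (f : T -> \bar R) :
  Mplus (Rplus R : set (measurableTypeR R)) (rearr mu Omega f).
Proof.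
split; last by move=> *; exact: rearr_ge0.
by apply: measurable_rearr; exact: is_interval_Rplus.
Qed.

Lemma sub_0oo_Rplus (t : R) : `]0%R, t[%classic `<=` Rplus R.
Proof. by move=> s; rewrite /Rplus/= !in_itv/= => /andP[->]. Qed.

Lemma ge0_le_integral_0oo (s t : R) g : Mplus (Rplus R) g -> (s <= t)%R ->
  \int[leb]_(u in `]0%R, s[) g u <= \int[leb]_(u in `]0%R, t[) g u.
Proof.
move=> [mg g0] st; apply: ge0_subset_integral => //.
- exact: (measurable_funS measurable_Rplus (@sub_0oo_Rplus t) mg).
- by move=> u /sub_0oo_Rplus; exact: g0.
- by apply: subset_itvl; rewrite bnd_simp.
Qed.

Lemma Mplus_opU h : Mplus (Rplus R) h -> Mplus (Rplus R) (opU h).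
Proof.
move=> Mh; split; last first.
  by move=> s _; apply: integral_ge0 => u /sub_0oo_Rplus; exact: Mh.2.
apply: nonincreasing_emeasurable; first exact: is_interval_Rplus.
move=> s t /RplusP s0 /RplusP t0 st; apply: ge0_le_integral_0oo => //.
by rewrite lef_pV2 ?posrE.
Qed.

(** Both factors, [1 / t] and the integral up to [t], are monotone, hence measurable. *)
Lemma Mplus_avg_rearr g : Mplus (Rplus R) (avg_rearr g).
Proof.
have Mr : Mplus (Rplus R) (rearrR g) := Mplus_rearr _ _ _.
split; last first.
  move=> t /RplusP t0; apply: mule_ge0; first by rewrite lee_fin invr_ge0 ltW.
  by apply: integral_ge0 => u _; exact: rearr_ge0.
apply: emeasurable_funM.
  apply: nonincreasing_emeasurable; first exact: is_interval_Rplus.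
  by move=> s t /RplusP s0 /RplusP t0 st; rewrite lee_fin lef_pV2 ?posrE.
apply: nondecreasing_emeasurable; first exact: is_interval_Rplus.
by move=> s t _ _ st; exact: ge0_le_integral_0oo.
Qed.

End half_line_operators.

(** * Truncating a nonincreasing function to []0, k[] *)

Section truncation.
Context {R : realType} (g : R -> \bar R).
Hypothesis g0 : forall t, 0 <= g t.
Hypothesis g_ni : forall s t, (s <= t)%R -> g t <= g s.
Hypothesis g_fin : forall t, (0 < t)%R -> g t < +oo.

(** Real-valued, as the Fourier hypothesis demands. Nonpositive arguments are cut off as well, since
    a rearrangement may be infinite there. *)
Definition truncation (k : R) (t : R) : R :=
  if (0 < t < k)%R then fine (g t) else 0%R.

Lemma truncationE k t : (0 < t < k)%R -> (truncation k t)%:E = g t.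
Proof.
move=> tk; rewrite /truncation tk fineK// ge0_fin_numE// g_fin//.
by case/andP: tk.
Qed.

Lemma truncation_ge0 k t : (0 <= truncation k t)%R.
Proof. by rewrite /truncation; case: ifPn => // _; rewrite fine_ge0. Qed.

Lemma truncation_le k t : (truncation k t)%:E <= g t.
Proof.
have [tk|tk] := boolP (0 < t < k)%R; first by rewrite truncationE.
by rewrite /truncation (negbTE tk).
Qed.

Lemma truncation_nonincreasing k s t : (0 < s)%R -> (s <= t)%R ->
  (truncation k t <= truncation k s)%R.
Proof.
move=> s0 st; have [/andP[t0 tk]|tk] := boolP (0 < t < k)%R; last first.
  by rewrite {1}/truncation (negbTE tk) truncation_ge0.
by rewrite -lee_fin !truncationE ?g_ni ?t0// s0 (le_lt_trans st).
Qed.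

Lemma truncation_nondecreasing k l t : (k <= l)%R ->
  (truncation k t <= truncation l t)%R.
Proof.
move=> kl; have [/andP[t0 tk]|tk] := boolP (0 < t < k)%R; last first.
  by rewrite {1}/truncation (negbTE tk) truncation_ge0.
by rewrite -lee_fin !truncationE ?t0// (lt_le_trans tk).
Qed.

Lemma truncation_eq0 k t : (k <= t)%R -> truncation k t = 0%R.
Proof. by move=> kt; rewrite /truncation (ltNge t) kt andbF. Qed.

Lemma measurable_truncation k :
  measurable_fun (setT : set (measurableTypeR R)) (truncation k).
Proof.
have mg : measurable_fun (setT : set (measurableTypeR R)) g.
  by apply: nonincreasing_emeasurable => // s t _ _; exact: g_ni.
apply: measurable_fun_ifT => //.
  by apply: measurable_and; exact: measurable_fun_ltr.
exact: measurableT_comp.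
Qed.

(** [opU] at [t] only sees []0, 1/t[], where the truncation changes nothing. *)
Lemma opU_truncation k t : (0 < t)%R -> (t^-1 <= k)%R ->
  opU (EFin \o truncation k) t = opU g t.
Proof.
move=> t0 tk; apply: eq_integral => s; rewrite inE/= in_itv/= => /andP[s0 st].
by rewrite truncationE// s0 (lt_le_trans st).
Qed.

End truncation.

(** * From the pointwise estimate to the norm inequality *)

Section main_step.
Context {R : realType} {n : nat}.
Variables (rhobar : (R -> \bar R) -> \bar R) (C : R) (H : R -> R).
Hypothesis n_gt0 : (0 < n)%N.
Hypothesis ri_rhobar : ri_norm (@lebesgue_measure R) (Rplus R) rhobar.
Hypothesis C_gt0 : (0 < C)%R.
Hypothesis rhobar_avg : forall g : R -> \bar R, Mplus (Rplus R) g ->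
  rhobar (avg_rearr g) <= C%:E * rhobar (rearrR g).
Hypothesis mH : measurable_fun (setT : set (measurableTypeR R)) H.
Hypothesis H0 : forall t, (0 <= H t)%R.
Hypothesis H_ni : forall s t, (0 < s)%R -> (s <= t)%R -> (H t <= H s)%R.
Hypothesis intf : (lebesgue_Rn R n).-integrable setT (EFin \o @radial R n H).

Definition fourier_const : R := (@radialK R n * (2 / cos 1) ^+ n)%R.

Lemma fourier_const_gt0 : (0 < fourier_const)%R.
Proof.
by rewrite mulr_gt0 ?radialK_gt0// exprn_gt0// divr_gt0// cos1_gt0.
Qed.

(** The averaging hypothesis is applied to [G], the rearranged transform. [G <= rearrR G] passes
    from the pointwise estimate to [avg_rearr G], and [rearrR G <= G] returns to [G] afterwards. *)
Lemma rhobar_opU_le : rhobar (opU (EFin \o H)) <=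
  (fourier_const * C)%:E * lift_norm rhobar
    (fun xi : n.-tuple R => (cabs (fourier (fun x => (radial H x)%:C%C) xi))%:E).
Proof.
set F := (X in lift_norm _ X); set G := rearrRn F.
have MG : Mplus (Rplus R) G := Mplus_rearr _ _ _.
have MrG : Mplus (Rplus R) (rearrR G) := Mplus_rearr _ _ _.
have MA := Mplus_avg_rearr G; have M0 := fourier_const_gt0.
have mF : measurable_fun setT F.
  apply/measurable_EFinP; apply: measurable_cabs_fourier.
  exact: measurable_radial.
have G_ni s t : (s <= t)%R -> G t <= G s by exact: rearr_nonincreasing.
have Gle t : (0 < t)%R -> rearrR G t <= G t.
  move=> t0; apply: rearrR_le => //; last by move=> s _; exact: rearr_ge0.
  by move=> s u _ _; exact: G_ni.
have MH : Mplus (Rplus R) (EFin \o H).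
  by split; [apply/measurable_EFinP; exact: measurable_funTS|
    move=> *; rewrite lee_fin].
apply: (@le_trans _ _ (rhobar (fun t => fourier_const%:E * avg_rearr G t))).
  apply: (ri_norm_le ri_rhobar); first exact: Mplus_opU.
    split; first by apply: measurable_funeM; exact: MA.1.
    by move=> t Rt; rewrite mule_ge0 ?lee_fin ?(ltW M0)//; exact: MA.2.
  move=> t /RplusP t0; apply: le_trans (opU_le_avg_fourier _ _ _ _ t0 intf) _ => //.
  rewrite lee_wpmul2l ?lee_fin ?(ltW M0)// /avg_rearr.
  rewrite lee_wpmul2l ?lee_fin ?invr_ge0 ?(ltW t0)//.
  apply: ge0_le_integral => //.
  - by move=> *; exact: rearr_ge0.
  - exact: (measurable_funS measurable_Rplus (@sub_0oo_Rplus _ t) MG.1).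
  - exact: (measurable_funS measurable_Rplus (@sub_0oo_Rplus _ t) MrG.1).
  by move=> s /sub_0oo_Rplus/RplusP s0; exact: rearr_le_rearrR.
rewrite (ri_scale ri_rhobar MA M0) (EFinM fourier_const) -muleA lee_wpmul2l ?lee_fin ?(ltW M0)//.
apply: le_trans (rhobar_avg MG) _; rewrite lee_wpmul2l ?lee_fin ?(ltW C_gt0)//.
apply: (ri_norm_le ri_rhobar) => // t /RplusP; exact: Gle.
Qed.

End main_step.

(** * The theorem, by truncation and the Fatou property *)

Unset Implicit Arguments.
Set Strict Implicit.
Set Printing Implicit Defensive.

Theorem theorem1p1 (R : realType) (n : nat) (n_gt0 : (0 < n)%N)
    (rhobar sigmabar : (R -> \bar R) -> \bar R)
    (ri_rhobar : ri_norm (@lebesgue_measure R) (Rplus R) rhobar)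
    (ri_sigmabar : ri_norm (@lebesgue_measure R) (Rplus R) sigmabar)
    (rhobar_avg : exists2 C : R, (0 < C)%R &
      forall g : R -> \bar R, Mplus (Rplus R) g ->
        rhobar (avg_rearr g) <= C%:E * rhobar (rearrR g))
    (fourier_bound : exists2 C : R, (0 < C)%R &
      forall g : R -> R,
        (forall s t : R, (0 < s)%R -> (s <= t)%R -> (g t <= g s)%R) ->
        let f := fun x : n.-tuple R => g (enorm x) in
        (lebesgue_Rn R n).-integrable setT (EFin \o f) ->
        Lri setT (lift_norm sigmabar) (EFin \o f) ->
        lift_norm rhobar
          (fun xi => (cabs (fourier (fun x => (f x)%:C%C) xi))%:E) <=
        C%:E * lift_norm sigmabar (fun x => `|(f x)%:E|)) :
  exists2 C : R, (0 < C)%R &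
    forall h : R -> \bar R, Lri (Rplus R) sigmabar h ->
      rhobar (opU (rearrR h)) <= C%:E * sigmabar (rearrR h).
Proof.
have [C1 C1_gt0 avgP] := rhobar_avg; have [C2 C2_gt0 fourierP] := fourier_bound.
have M_gt0 := @fourier_const_gt0 R n n_gt0.
pose C := (@fourier_const R n * C1 * C2)%R.
have MC1_gt0 := mulr_gt0 M_gt0 C1_gt0.
have C_gt0 : (0 < C)%R := mulr_gt0 MC1_gt0 C2_gt0.
exists C => // h _; set g := rearrR h.
have Mg : Mplus (Rplus R) g := Mplus_rearr _ _ _.
have g0 t : 0 <= g t by exact: rearr_ge0.
have g_ni s t : (s <= t)%R -> g t <= g s by exact: rearr_nonincreasing.
have [gy|gy] := eqVneq (sigmabar g) +oo; first by rewrite gy gt0_muley ?leey// lte_fin.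
have {}gy : sigmabar g < +oo by rewrite ltey.
have int_g t : (0 < t)%R -> \int[lebesgue_measure]_(s in `]0%R, t[) g s < +oo.
  move=> t0.
  have [|||D D0 DP] := ri_integral ri_sigmabar (E := `]0%R, t[%classic).
  - exact: measurable_itv.
  - exact: sub_0oo_Rplus.
  - by rewrite lebesgue_measure_0oo ?ltry// ltW.
  by apply: le_lt_trans (DP _ Mg) _; rewrite lte_mul_pinfty// lee_fin ltW.
(* An infinite value at [t] would spread over all of []0, t[] by monotonicity and contradict
   [int_g]. *)
have g_fin t : (0 < t)%R -> g t < +oo.
  move=> t0; rewrite ltey; apply/eqP => gty; have := int_g _ t0.
  rewrite ltNge => /negP; apply.
  apply: (@le_trans _ _ (\int[lebesgue_measure]_(s in `]0%R, t[) cst +oo s)).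
    by rewrite integral_cst// [X in _ * X]lebesgue_measure_0oo ?(ltW t0)// gt0_mulye ?lte_fin.
  apply: ge0_le_integral => //; first by move=> s _; exact: leey.
    exact: (measurable_funS measurable_Rplus (@sub_0oo_Rplus _ t) Mg.1).
  by move=> s; rewrite /= in_itv/= => /andP[_ st]; rewrite -gty g_ni// ltW.
(* The successor keeps the truncation point positive at [k = 0]. *)
pose H k := truncation g k.+1%:R.
have step k : rhobar (opU (EFin \o H k)) <= C%:E * sigmabar g.
  have k0 : (0 < k.+1%:R :> R)%R by [].
  have mH := measurable_truncation g_ni k.+1%:R : measurable_fun setT (H k).
  have H0 t : (0 <= H k t)%R by exact: truncation_ge0.
  have Hni s t : (0 < s)%R -> (s <= t)%R -> (H k t <= H k s)%R.
    exact: truncation_nonincreasing.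
  have intf : (lebesgue_Rn R n).-integrable setT (EFin \o @radial R n (H k)).
    apply: (integrable_radial _ _ _ _ k0) => //.
      by move=> t; exact: truncation_eq0.
    apply: le_lt_trans (int_g _ k0); apply: ge0_le_integral => //.
    - by move=> *; rewrite lee_fin.
    - by apply/measurable_EFinP; exact: measurable_funTS.
    - exact: (measurable_funS measurable_Rplus (@sub_0oo_Rplus _ k.+1%:R) Mg.1).
    by move=> t _; exact: truncation_le.
  (* The rearrangement of the radial function is below [H k], hence below [g]. This gives both
     membership in the space of [sigma] and the final bound. *)
  have sle : sigmabar (rearrRn (fun x : n.-tuple R => `|(radial (H k) x)%:E|)) <= sigmabar g.
    apply: (ri_norm_le ri_sigmabar) => //; first exact: Mplus_rearr.
    move=> t /RplusP t0; apply: le_trans (truncation_le g0 g_fin k.+1%:R t).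
    rewrite /rearrRn (_ : (fun x => _) = EFin \o @radial R n (H k)).
      exact: rearr_radial.
    by apply/funext => x; rewrite /= ger0_norm// H0.
  have f_ni s t : (0 < s)%R -> (s <= t)%R ->
      (H k ((pi * t) ^+ n) <= H k ((pi * s) ^+ n))%R.
    move=> s0 st; apply: Hni; first by rewrite exprn_gt0// mulr_gt0// pi_gt0.
    have t0 := lt_le_trans s0 st.
    rewrite lerXn2r ?nnegrE ?mulr_ge0 ?pi_ge0 ?(ltW s0) ?(ltW t0)//.
    by rewrite ler_wpM2l ?pi_ge0.
  (* This profile, evaluated at [enorm x], is [radial (H k) x]. *)
  have fle := fourierP (fun s => H k ((pi * s) ^+ n)%R) f_ni intf.
  apply: le_trans (rhobar_opU_le n_gt0 ri_rhobar C1_gt0 avgP mH H0 Hni intf) _.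
  rewrite /C (EFinM (_ * C1)) -muleA lee_wpmul2l ?lee_fin ?(ltW MC1_gt0)//.
  apply: le_trans (fle _) _; last by rewrite lee_wpmul2l ?lee_fin ?(ltW C2_gt0).
  split; first by apply/measurable_EFinP; exact: measurable_radial.
  exact: le_lt_trans sle gy.
have MH k : Mplus (Rplus R) (EFin \o H k).
  split; last by move=> t _; rewrite lee_fin truncation_ge0.
  by apply/measurable_EFinP/measurable_funTS; exact: measurable_truncation.
have [||||_ lim_rho] := @ri_fatou _ _ _ _ _ _ ri_rhobar
    (fun k => opU (EFin \o H k)) (opU g).
- by move=> k; exact: Mplus_opU.
- exact: Mplus_opU.
- move=> t Rt k l kl; apply: ge0_le_integral => //.
  + by move=> s _; rewrite lee_fin truncation_ge0.
  + exact: (measurable_funS measurable_Rplus (@sub_0oo_Rplus _ _) (MH k).1).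
  + exact: (measurable_funS measurable_Rplus (@sub_0oo_Rplus _ _) (MH l).1).
  move=> s _; rewrite lee_fin; apply: truncation_nondecreasing => //.
  by rewrite ler_nat ltnS.
(* Once [k] passes [1 / t] the truncation is exact at [t], so the sequence is eventually constant
   there. *)
- move=> t /RplusP t0; apply: cvg_near_cst.
  exists (Num.bound t^-1) => // k /= tk; apply: opU_truncation => //.
  apply: (le_trans (ltW (archi_boundP _))); first by rewrite invr_ge0 ltW.
  by rewrite ler_nat (leq_trans tk).
have -> : rhobar (opU g) = limn (fun k => rhobar (opU (EFin \o H k))).
  by apply/esym/cvg_lim.
apply: lime_le; first by apply/cvg_ex; exists (rhobar (opU g)).
by apply: nearW => k; exact: step.
Qed.
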